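(* Let $d\in\mathbb N$, $\mathcal D=\{1,\dots,d\}$, $U\subseteq\mathcal P(\mathcal D)$ a subset of ANOVA terms and $w:\mathbb Z^d\to[1,\infty)$ a weight function. If $f\in\mathcal A^w(\mathbb T^d)$, then $$\frac{\|f-\mathrm T_Uf\|_{\mathrm L_\infty(\mathbb T^d)}}{\|f\|_{\mathcal A^w(\mathbb T^d)}}\le\frac{1}{\min_{\mathbf k\in\bigcup_{\mathbf u\subseteq\mathcal D,\,\mathbf u\notin U}\mathbb F^{(d)}_{\mathbf u}}w(\mathbf k)}.$$ If $f\in\mathrm H^w(\mathbb T^d)$ and $\{1/w(\mathbf k)\}_{\mathbf k\in\mathbb Z^d}\in\ell_2$, then $$\|f-\mathrm T_Uf\|_{\mathrm L_\infty(\mathbb T^d)}\le\sqrt{\sum_{\mathbf k\in\bigcup_{\mathbf u\subseteq\mathcal D,\,\mathbf u\notin U}\mathbb F^{(d)}_{\mathbf u}}\frac{1}{w(\mathbf k)^2}}\ \|f\|_{\mathrm H^w(\mathbb T^d)}.$$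
   Context: $\mathbb T=[0,1)$ with periodic identification; $c_{\mathbf k}(g)=\int_{\mathbb T^d} g(\mathbf x)e^{-2\pi i\mathbf k\cdot\mathbf x}\,d\mathbf x$. $\mathrm H^w(\mathbb T^d)=\{g\in\mathrm L_2:\|g\|_{\mathrm H^w}=(\sum_{\mathbf k}w(\mathbf k)^2|c_{\mathbf k}(g)|^2)^{1/2}<\infty\}$; $\mathcal A^w(\mathbb T^d)=\{g\in\mathrm L_1:\|g\|_{\mathcal A^w}=\sum_{\mathbf k}w(\mathbf k)|c_{\mathbf k}(g)|<\infty\}$. For $\mathbf u\subseteq\mathcal D$: $\mathbf u^c=\mathcal D\setminus\mathbf u$, $\mathrm P_{\mathbf u}f(\mathbf x_{\mathbf u})=\int_{\mathbb T^{|\mathbf u^c|}}f(\mathbf x)\,d\mathbf x_{\mathbf u^c}$, ANOVA terms $f_{\mathbf u}=\mathrm P_{\mathbf u}f-\sum_{\mathbf v\subsetneq\mathbf u}f_{\mathbf v}$ (recursively), $\mathbb F^{(d)}_{\mathbf u}=\{\mathbf k\in\mathbb Z^d:\mathbf k_{\mathbf u^c}=\mathbf 0,\ k_j\neq0\ \forall j\in\mathbf u\}$. A subset of ANOVA terms is $U\subseteq\mathcal P(\mathcal D)$ closed under taking subsets; $\mathrm T_Uf=\sum_{\mathbf u\in U}f_{\mathbf u}$. *)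

(* Defs.v *)
From HB Require Import structures.
From mathcomp Require Import all_boot all_order all_algebra.
From mathcomp Require Import all_classical all_reals all_analysis.
From mathcomp Require Import complex ess_sup_inf.
Set Implicit Arguments. Unset Strict Implicit. Unset Printing Implicit Defensive.
Import Order.TTheory GRing.Theory Num.Theory.
Import numFieldNormedType.Exports.
Local Open Scope classical_set_scope.
Local Open Scope ring_scope.

(*   tlam R d  : the product measure  U[0,1] \x ... \x U[0,1]  (d factors),   *)
(*               i.e. Lebesgue measure restricted to [0,1]^d (which agrees    *)
(*               with the Haar = Lebesgue measure on T^d = [0,1)^d, the       *)
(*               boundary being a null set).                                  *)
(*   tcoord x j : the j-th coordinate (j = 0, ..., d-1) of x; D = {1..d} is   *)
(*               indexed by 'I_d = {0, ..., d-1}.                             *)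

Section Torus.
Variable R : realType.

Lemma lt01 : (0:R) < 1. Proof. by []. Qed.

Fixpoint torus (n : nat) : {d : measure_display & measurableType d} :=
  match n with
  | 0 => existT (fun d => measurableType d) _ (unit : measurableType _)
  | n.+1 => existT (fun d => measurableType d) _
              ((projT2 (torus n) * measurableTypeR R)%type : measurableType _)
  end.

Definition Td (n : nat) := projT2 (torus n).

Fixpoint tlam (n : nat) : probability (Td n) R :=
  match n return probability (Td n) R with
  | 0 => (\d_ tt : probability _ R)
  | n.+1 => ((tlam n \x uniform_prob lt01)%E : probability _ R)
  end.

Fixpoint tcoord (n : nat) : Td n -> nat -> R :=
  match n return Td n -> nat -> R with
  | 0 => fun _ _ => 0
  | m.+1 => fun (x : (Td m * R)%type) (j : nat) =>
              if j == m then snd x else @tcoord m (fst x) j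
  end.

Fixpoint tbuild (n : nat) (g : nat -> R) : Td n :=
  match n return Td n with
  | 0 => tt
  | m.+1 => ((@tbuild m g, g m) : (Td m * R)%type)
  end.

Definition expi (t : R) : R[i] := (cos t +i* sin t)%C.

Definition cintegral d (T : measurableType d) (mu : {measure set T -> \bar R})
  (g : T -> R[i]) : R[i] :=
  (Rintegral mu setT (fun x => complex.Re (g x)) +i* Rintegral mu setT (fun x => complex.Im (g x)))%C.

Definition cmeasurable d (T : measurableType d) (g : T -> R[i]) :=
  measurable_fun setT (fun x => complex.Re (g x)) /\ measurable_fun setT (fun x => complex.Im (g x)).

Variable dim : nat.
Local Notation T := (Td dim).
Local Notation lam := (tlam dim).

Definition freq := {ffun 'I_dim -> int}.

Definition kdot (k : freq) (x : T) : R :=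
  \sum_(j < dim) (k j)%:~R * tcoord x j.

Definition fcoef (g : T -> R[i]) (k : freq) : R[i] :=
  cintegral lam (fun x => g x * expi (- (2 * pi * kdot k x))).

Definition inL1 (g : T -> R[i]) :=
  cmeasurable g /\ lam.-integrable setT (fun x => (Normc.normc (g x))%:E).
Definition inL2 (g : T -> R[i]) :=
  cmeasurable g /\ lam.-integrable setT (fun x => (Normc.normc (g x) ^+ 2)%:E).

Definition Linf_norm (g : T -> R[i]) : \bar R :=
  ess_sup lam (fun x => (Normc.normc (g x))%:E).

Definition Aw_sum (w : freq -> R) (g : T -> R[i]) : \bar R :=
  esum setT (fun k => (w k * Normc.normc (fcoef g k))%:E).
Definition inAw (w : freq -> R) (g : T -> R[i]) :=
  inL1 g /\ (Aw_sum w g < +oo)%E.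
Definition Aw_norm (w : freq -> R) (g : T -> R[i]) : R := fine (Aw_sum w g).

Definition Hw_sum (w : freq -> R) (g : T -> R[i]) : \bar R :=
  esum setT (fun k => (w k ^+ 2 * Normc.normc (fcoef g k) ^+ 2)%:E).
Definition inHw (w : freq -> R) (g : T -> R[i]) :=
  inL2 g /\ (Hw_sum w g < +oo)%E.
Definition Hw_norm (w : freq -> R) (g : T -> R[i]) : R := Num.sqrt (fine (Hw_sum w g)).

Definition in_u (u : {set 'I_dim}) (j : nat) : bool :=
  [exists i : 'I_dim, (i \in u) && (val i == j)].

Definition mixpt (u : {set 'I_dim}) (x y : T) : T :=
  tbuild dim (fun j => if in_u u j then tcoord x j else tcoord y j).

(* P_u g (x_u) = int_{T^{|u^c|}} g(x) dx_{u^c}, viewed as a function on T^d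
   depending only on x_u *)
Definition Pu (u : {set 'I_dim}) (g : T -> R[i]) (x : T) : R[i] :=
  cintegral lam (fun y => g (mixpt u x y)).

(* g_u = P_u g - sum_{v strictly included in u} g_v  (recursion on |u|) *)
Fixpoint anova_aux (g : T -> R[i]) (n : nat) (u : {set 'I_dim}) (x : T) : R[i] :=
  match n with
  | 0 => Pu u g x
  | n.+1 => Pu u g x - \sum_(v : {set 'I_dim} | v \proper u) anova_aux g n v x
  end.

Definition anova_term (g : T -> R[i]) (u : {set 'I_dim}) : T -> R[i] :=
  anova_aux g #|u| u.

Definition anova_subset (U : {set {set 'I_dim}}) : Prop :=
  forall u v : {set 'I_dim}, u \in U -> v \subset u -> v \in U.

Definition TU (U : {set {set 'I_dim}}) (g : T -> R[i]) (x : T) : R[i] :=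
  \sum_(u in U) anova_term g u x.

Definition Fu (u : {set 'I_dim}) : set freq :=
  [set k | forall j : 'I_dim, (j \notin u -> k j = 0) /\ (j \in u -> k j != 0)].

Definition Fout (U : {set {set 'I_dim}}) : set freq :=
  [set k | exists u : {set 'I_dim}, u \notin U /\ Fu u k].

End Torus.

(* Main.v *)
(** If [h] is integrable on the torus, then [|h| <= \sum_k |c_k(h)|] almost
everywhere.  In dimension one, testing [h] against a trigonometric polynomial
[phi] gives [|\int h phi| <= (\sum_k |c_k(h)|) \int |phi|]; trigonometric
polynomials converging boundedly to the indicator of an interval [I] turn this
into [|\int_I h| <= (\sum_k |c_k(h)|) |I|], and Lebesgue differentiation gives
the pointwise bound.  Fubini reduces dimension [n + 1] to dimensions [n] and 1.
The theorem applies this bound to [h = f - T_U f], whose Fourier coefficients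
are those of [f] on the frequencies with support outside [U], and 0 elsewhere:
this rests on [c_k(P_u f) = c_k(f)] if the support of [k] lies in [u], and 0
otherwise.  The second estimate is then Cauchy-Schwarz. *)
Require Import Defs.
From HB Require Import structures.
From mathcomp Require Import all_boot all_order all_algebra.
From mathcomp Require Import all_classical all_reals all_analysis.
From mathcomp Require Import complex ess_sup_inf measurable_realfun.
From mathcomp Require Import ring lra.
Set Implicit Arguments. Unset Strict Implicit. Unset Printing Implicit Defensive.
Import Order.TTheory GRing.Theory Num.Theory.
Import numFieldNormedType.Exports.
Local Open Scope classical_set_scope.
Local Open Scope ring_scope.

(** The usual route identifies [f] with its absolutely convergent Fourier series, which rests on the
    uniqueness theorem for Fourier coefficients. Only an inequality is wanted here, and duality
    gives it directly. Nonnegative test functions are essential: their L1 norms are their integrals,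
    so these norms tend to [|I|] with no constant lost. They are obtained by composing the
    polynomials [(1 - x^n)^(2^n)], which separate [x < 1/2] from [x > 1/2] on [0, 1], with a
    trigonometric polynomial of degree 1 that crosses the level 1/2 at the endpoints of [I]. The
    other obstacle is [Pu], which draws a whole auxiliary point [y] and mixes its coordinates with
    those of [x]. Exchanging the coordinates outside [u] between the two points preserves the
    product measure and moves the mixture into the character, which factors over coordinates. *)

Local Notation Re := complex.Re.
Local Notation Im := complex.Im.
Local Notation normc := Normc.normc.

(** * Complex integrals *)

Section ComplexNorm.
Context {R : realType}.
Implicit Types z : R[i].

Lemma normc_ge0 z : 0 <= normc z.
Proof. by case: z => a b; rewrite sqrtr_ge0. Qed.

Lemma sqr_normcE z : normc z ^+ 2 = Re z ^+ 2 + Im z ^+ 2.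
Proof. by case: z => a b; rewrite /= sqr_sqrtr// addr_ge0 ?sqr_ge0. Qed.

Lemma normc_le z (M : R) : 0 <= M -> Re z ^+ 2 + Im z ^+ 2 <= M ^+ 2 -> normc z <= M.
Proof. by move=> M0; rewrite -sqr_normcE ler_sqr ?nnegrE ?normc_ge0. Qed.

Lemma normc_Re z : `|Re z| <= normc z.
Proof.
by rewrite -ler_sqr ?nnegrE ?normc_ge0// sqr_normcE real_normK ?num_real// lerDl sqr_ge0.
Qed.

Lemma normc_Im z : `|Im z| <= normc z.
Proof.
by rewrite -ler_sqr ?nnegrE ?normc_ge0// sqr_normcE real_normK ?num_real// lerDr sqr_ge0.
Qed.

Lemma normc_ReIm z : normc z <= `|Re z| + `|Im z|.
Proof.
apply: normc_le; first by rewrite addr_ge0.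
rewrite sqrrD !real_normK ?num_real// -addrA lerD2l lerDr.
by rewrite mulrn_wge0// mulr_ge0.
Qed.

Lemma ReD z1 z2 : Re (z1 + z2) = Re z1 + Re z2. Proof. by case: z1 z2 => ? ? []. Qed.
Lemma ImD z1 z2 : Im (z1 + z2) = Im z1 + Im z2. Proof. by case: z1 z2 => ? ? []. Qed.
Lemma ReM z1 z2 : Re (z1 * z2) = Re z1 * Re z2 - Im z1 * Im z2.
Proof. by case: z1 z2 => ? ? []. Qed.
Lemma ImM z1 z2 : Im (z1 * z2) = Re z1 * Im z2 + Im z1 * Re z2.
Proof. by case: z1 z2 => ? ? []. Qed.

Lemma complex_eqP z1 z2 : Re z1 = Re z2 -> Im z1 = Im z2 -> z1 = z2.
Proof. by case: z1 z2 => ? ? [? ?] /= -> ->. Qed.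

Lemma normc_sum (I : Type) (r : seq I) (F : I -> R[i]) :
  normc (\sum_(i <- r) F i) <= \sum_(i <- r) normc (F i).
Proof.
elim: r => [|i r IH]; first by rewrite !big_nil Normc.normc0.
rewrite !big_cons; apply: le_trans (le_normcD _ _) _.
by rewrite lerD2l.
Qed.

End ComplexNorm.

Section ComplexIntegral.
Context d {T : measurableType d} {R : realType} (mu : {measure set T -> \bar R}).
Implicit Types (f g : T -> R[i]) (c : R[i]).

Definition cintegrable f :=
  mu.-integrable setT (EFin \o (fun x => Re (f x))) /\
  mu.-integrable setT (EFin \o (fun x => Im (f x))).

Lemma cintegrable_measurable f : cintegrable f -> cmeasurable f.
Proof.
by case=> /measurable_int/measurable_EFinP mr /measurable_int/measurable_EFinP mi.
Qed.

Lemma cmeasurable_normc f : cmeasurable f -> measurable_fun setT (fun x => normc (f x)).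
Proof.
move=> [mr mi].
rewrite (_ : (fun x => _) = (fun x => Num.sqrt (Re (f x) ^+ 2 + Im (f x) ^+ 2))); last first.
  by apply/funext => x; case: (f x).
apply: (measurableT_comp (measurable_funTS _)) => //.
  apply: continuous_measurable_fun; exact: sqrt_continuous.
by apply: measurable_funD; apply: measurable_funX.
Qed.

Lemma cintegrable_normc f : cintegrable f -> mu.-integrable setT (fun x => (normc (f x))%:E).
Proof.
move=> fi; have [ir ii] := fi.
apply: le_integrable (integrableD measurableT (integrable_abse ir) (integrable_abse ii)) => //.
  by apply/measurable_EFinP/cmeasurable_normc/cintegrable_measurable.
move=> x _ /=; rewrite lee_fin ger0_norm ?normc_ge0//.
by rewrite (ger0_norm (addr_ge0 _ _))// normc_ReIm.
Qed.

Lemma cintegrableP f : cmeasurable f ->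
  mu.-integrable setT (fun x => (normc (f x))%:E) -> cintegrable f.
Proof.
move=> [mr mi] i; split; apply: le_integrable i => //;
  first exact/measurable_EFinP.
- by move=> x _ /=; rewrite lee_fin (ger0_norm (normc_ge0 _)) normc_Re.
- exact/measurable_EFinP.
- by move=> x _ /=; rewrite lee_fin (ger0_norm (normc_ge0 _)) normc_Im.
Qed.

Lemma cmeasurableM f g : cmeasurable f -> cmeasurable g ->
  cmeasurable (fun x => f x * g x).
Proof.
move=> [fr fi] [gr gi]; split.
- under eq_fun do rewrite ReM.
  by apply: measurable_funB; apply: measurable_funM.
- under eq_fun do rewrite ImM.
  by apply: measurable_funD; apply: measurable_funM.
Qed.

Lemma cintegrable_bounded f g (M : R) : cintegrable f -> cmeasurable g ->
  (forall x, normc (g x) <= M) -> cintegrable (fun x => f x * g x).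
Proof.
move=> fi mg gM; have mf := cintegrable_measurable fi.
apply: cintegrableP; first exact: cmeasurableM.
apply: le_integrable (integrableZl measurableT M (cintegrable_normc fi)) => //.
  exact/measurable_EFinP/cmeasurable_normc/cmeasurableM.
move=> x _; rewrite -EFinM !abse_EFin lee_fin Normc.normcM.
rewrite !normrM !(ger0_norm (normc_ge0 _)) mulrC ler_wpM2r ?normc_ge0//.
exact: le_trans (gM x) (ler_norm _).
Qed.

Lemma cintegrableD f g : cintegrable f -> cintegrable g ->
  cintegrable (fun x => f x + g x).
Proof.
move=> [fr fi] [gr gi]; split.
- rewrite (_ : _ \o _ = (EFin \o (fun x => Re (f x))) \+ (EFin \o (fun x => Re (g x)))).
    exact: integrableD.
  by apply/funext => x /=; rewrite ReD.
- rewrite (_ : _ \o _ = (EFin \o (fun x => Im (f x))) \+ (EFin \o (fun x => Im (g x)))).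
    exact: integrableD.
  by apply/funext => x /=; rewrite ImD.
Qed.

Lemma cintegralD f g : cintegrable f -> cintegrable g ->
  cintegral mu (fun x => f x + g x) = cintegral mu f + cintegral mu g.
Proof.
move=> [fr fi] [gr gi]; apply: complex_eqP => /=.
- by under eq_Rintegral do rewrite ReD; rewrite RintegralD.
- by under eq_Rintegral do rewrite ImD; rewrite RintegralD.
Qed.

Lemma cintegrableZ c f : cintegrable f -> cintegrable (fun x => c * f x).
Proof.
move=> [fr fi]; split.
- rewrite (_ : _ \o _ = (fun x => (Re c)%:E * (Re (f x))%:E + (- Im c)%:E * (Im (f x))%:E)%E).
    by apply: integrableD => //; exact: integrableZl.
  by apply/funext => x /=; rewrite ReM -!EFinM -EFinD mulNr.
- rewrite (_ : _ \o _ = (fun x => (Re c)%:E * (Im (f x))%:E + (Im c)%:E * (Re (f x))%:E)%E).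
    by apply: integrableD => //; exact: integrableZl.
  by apply/funext => x /=; rewrite ImM -!EFinM -EFinD.
Qed.

Let integrableZ (r : R) (h : T -> R) : mu.-integrable setT (EFin \o h) ->
  mu.-integrable setT (EFin \o (fun x => r * h x)).
Proof.
move=> hi; rewrite (_ : _ \o _ = (fun x => r%:E * (h x)%:E)%E); first exact: integrableZl.
by apply/funext => x /=; rewrite EFinM.
Qed.

Lemma cintegralZ c f : cintegrable f ->
  cintegral mu (fun x => c * f x) = c * cintegral mu f.
Proof.
move=> [fr fi]; apply: complex_eqP => /=.
- under eq_Rintegral do rewrite ReM.
  by rewrite RintegralB//; [rewrite !RintegralZl// ReM|exact: integrableZ|exact: integrableZ].
- under eq_Rintegral do rewrite ImM.
  by rewrite RintegralD//; [rewrite !RintegralZl// ImM|exact: integrableZ|exact: integrableZ].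
Qed.

Lemma cintegrable0 : cintegrable (fun _ => 0).
Proof. by split; exact: integrable0. Qed.

Lemma cintegral0 : cintegral mu (fun _ => 0) = 0.
Proof. by apply: complex_eqP; rewrite /= /Rintegral integral0. Qed.

Lemma cintegrable_sum (I : Type) (r : seq I) (P : pred I) (F : I -> T -> R[i]) :
  (forall i, cintegrable (F i)) -> cintegrable (fun x => \sum_(i <- r | P i) F i x).
Proof.
move=> Fi; elim: r => [|i r IH].
  by under [X in cintegrable X]funext do rewrite big_nil; exact: cintegrable0.
under [X in cintegrable X]funext do rewrite big_cons.
by case: (P i) => //; apply: cintegrableD.
Qed.

Lemma cintegral_sum (I : Type) (r : seq I) (P : pred I) (F : I -> T -> R[i]) :
  (forall i, cintegrable (F i)) ->
  cintegral mu (fun x => \sum_(i <- r | P i) F i x) = \sum_(i <- r | P i) cintegral mu (F i).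
Proof.
move=> Fi; elim: r => [|i r IH].
  by under [X in cintegral _ X]funext do rewrite big_nil; rewrite cintegral0 big_nil.
under [X in cintegral _ X]funext do rewrite big_cons.
rewrite big_cons; case: (P i) => //; rewrite cintegralD ?IH//.
exact: cintegrable_sum.
Qed.

(* For [z = \int f], compare the real part of [z^* \int f = |z|^2] with [|z| \int |f|]. *)
Lemma normc_cintegral f : cintegrable f ->
  normc (cintegral mu f) <= \int[mu]_x normc (f x).
Proof.
move=> fi; set z := cintegral mu f.
have ni := cintegrable_normc fi.
have I0 : 0 <= \int[mu]_x normc (f x) by apply: Rintegral_ge0 => x _; exact: normc_ge0.
have [z0|z0] := eqVneq (normc z) 0; first by rewrite z0.
have zgt0 : 0 < normc z by rewrite lt_neqAle eq_sym z0 normc_ge0.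
rewrite -(ler_pM2l zgt0) -expr2.
pose c : R[i] := (Re z -i* Im z)%C.
have nc : normc c = normc z by rewrite /c; case: (z) => a b /=; rewrite sqrrN.
have -> : normc z ^+ 2 = Re (cintegral mu (fun x => c * f x)).
  by rewrite cintegralZ// -/z sqr_normcE /c; case: (z) => a b /=; ring.
rewrite -RintegralZl//; apply: le_Rintegral => //.
- by have [] := cintegrableZ c fi.
- exact: integrableZ.
- move=> x _; apply: le_trans (ler_norm _) _.
  by apply: le_trans (normc_Re _) _; rewrite Normc.normcM nc.
Qed.

Lemma eq_cintegral f g : f =1 g -> cintegral mu f = cintegral mu g.
Proof. by move=> /funext ->. Qed.

End ComplexIntegral.

(** * Fubini for complex functions *)

Section ComplexFubini.
Context d1 d2 {T1 : measurableType d1} {T2 : measurableType d2} {R : realType}.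
Context (m1 : probability T1 R) (m2 : probability T2 R).
Implicit Type f : T1 * T2 -> R[i].

(** [Rintegral] is [fine] of the extended integral, so the two inner integrals may differ at an [x]
    whose section is not integrable. Such [x] form a null set, which changes neither integrability
    nor the outer integral. *)
Let ae_fin (h : T1 * T2 -> R) :
  (m1 \x m2)%E.-integrable setT (EFin \o h) ->
  m1.-integrable setT (EFin \o (fun x => \int[m2]_y h (x, y))) /\
  \int[m1]_x \int[m2]_y h (x, y) = \int[(m1 \x m2)%E]_z h z.
Proof.
move=> hi.
have mF := measurable_fubini_F hi.
have iF := integrable_fubini_F hi.
have aeF : {ae m1, forall x, [set: T1] x ->
    (EFin \o (fun x => \int[m2]_y h (x, y))) x = fubini_F m2 (EFin \o h) x}.
  have := ae_integrable1 hi; apply: filterS => x hx _.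
  by rewrite /= fineK//; exact: integrable_fin_num.
have mG : measurable_fun setT (EFin \o (fun x => \int[m2]_y h (x, y))).
  by apply/measurable_EFinP; exact: (measurableT_comp _ mF).
split; last first.
  rewrite /Rintegral; congr fine; rewrite -(integral12_prod_meas1 hi).
  exact: ae_eq_integral.
apply/integrableP; split => //.
have /integrableP[_] := iF; apply: le_lt_trans.
apply: ae_ge0_le_integral => //.
- exact: measurableT_comp.
- exact: measurableT_comp.
- by apply: filterS aeF => x /(_ I) <-.
Qed.

Lemma cfubini1 f : cintegrable (m1 \x m2)%E f ->
  cintegrable m1 (fun x => cintegral m2 (fun y => f (x, y))) /\
  cintegral m1 (fun x => cintegral m2 (fun y => f (x, y))) = cintegral (m1 \x m2)%E f.
Proof.
move=> [fr fi]; have [r1 r2] := ae_fin fr; have [i1 i2] := ae_fin fi.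
by split => //; apply: complex_eqP.
Qed.

Lemma ae_cintegrable1 f : cintegrable (m1 \x m2)%E f ->
  {ae m1, forall x, cintegrable m2 (fun y => f (x, y))}.
Proof.
by move=> [fr fi]; have := ae_integrable1 fi; have := ae_integrable1 fr; apply: filterS2.
Qed.

End ComplexFubini.

(** * The characters of the circle *)

Section Expi.
Context {R : realType}.
Implicit Types s t : R.

Lemma expiD s t : expi (s + t) = expi s * expi t.
Proof.
apply: complex_eqP; rewrite ?ReM ?ImM /= ?cosD ?sinD//.
by rewrite addrC mulrC [in X in _ + X]mulrC [X in _ + X]mulrC; ring.
Qed.

Lemma expi0 : expi (0 : R) = 1.
Proof. by rewrite /expi cos0 sin0. Qed.

Lemma normc_expi t : normc (expi t) = 1.
Proof. by rewrite /= cos2Dsin2 sqrtr1. Qed.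

Lemma expiX t n : expi t ^+ n = expi (t *+ n).
Proof. by elim: n => [|n IH]; rewrite ?expr0 ?expi0// exprS mulrS expiD IH. Qed.

Lemma expiNK t : expi (- t) * expi t = 1.
Proof. by rewrite -expiD addNr expi0. Qed.

Lemma expi_int (m : int) : expi (2 * pi * m%:~R : R) = 1.
Proof.
have pos n : expi (2 * pi * n%:R : R) = 1.
  rewrite mulr_natr -expiX /expi mulr_natl cos2pi sin2pi.
  by rewrite (_ : (1 +i* 0)%C = 1) ?expr1n.
case: m => n; first exact: pos.
rewrite NegzE mulrNz mulrN; have := expiNK (2 * pi * n.+1%:R); rewrite pos mulr1.
exact.
Qed.

Lemma cmeasurable_expi d (T : measurableType d) (f : T -> R) :
  measurable_fun setT f -> cmeasurable (fun x => expi (f x)).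
Proof.
move=> mf; split => /=.
- apply: (measurableT_comp (measurable_funTS _)) => //.
  by apply: continuous_measurable_fun; exact: continuous_cos.
- apply: (measurableT_comp (measurable_funTS _)) => //.
  by apply: continuous_measurable_fun; exact: continuous_sin.
Qed.

End Expi.

(** * The uniform law on [0, 1] and orthogonality of the characters *)

Section UniformIntegral.
Context {R : realType}.
Local Notation mu := (@lebesgue_measure R).
Local Notation unif := (uniform_prob (@lt01 R)).
Local Open Scope ereal_scope.

Lemma integral_uniform01 (f : R -> \bar R) : measurable_fun setT f ->
  \int[unif]_x f x = \int[mu]_(x in `[0%R, 1%R]) f x.
Proof.
move=> mf; rewrite integralE [RHS]integralE !integral_uniform//.
- by rewrite subr0 invr1 !mul1e.
- exact: measurable_funeneg.
- exact: measurable_funepos.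
Qed.

Lemma integrable_uniform01 (f : R -> \bar R) : measurable_fun setT f ->
  unif.-integrable setT f <-> mu.-integrable `[0%R, 1%R] f.
Proof.
move=> mf; have mf1 : measurable_fun (`[0%R, 1%R] : set R) f by exact: measurable_funTS.
split=> /integrableP[_ fi]; apply/integrableP; split => //; move: fi;
  by rewrite integral_uniform01//; exact: measurableT_comp.
Qed.

(** The endpoints 0 and 1 are Lebesgue-null. Both the pointwise limits of [arc_step] and Lebesgue
    differentiation give information on the open interval only. *)
Lemma ae_uniform01 (P : set R) : measurable P ->
  {ae mu, forall x, (`]0%R, 1%R[%classic x -> P x)} -> {ae unif, forall x, P x}.
Proof.
move=> mP aeP; exists (~` P); split => //; first exact: measurableC.
rewrite /uniform_prob integral_uniform_pdf.
apply/eqP; rewrite eq_le; apply/andP; split; last first.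
  by apply: integral_ge0 => x _; rewrite lee_fin uniform_pdf_ge0// lt01.
have mCP : measurable (~` P `&` `[0%R, 1%R]) by apply: measurableI => //; exact: measurableC.
have N0 : mu (~` P `&` `[0%R, 1%R]) = 0.
  apply: measure_negligible => //.
  have n01 : mu.-negligible [set 0%R; 1%R].
    exists [set 0%R; 1%R]; split => //; first exact: measurableU.
    apply: (@null_set_setU _ _ _ mu); first exact: measurable_set1.
    - exact: measurable_set1.
    - exact: lebesgue_measure_set1.
    - exact: lebesgue_measure_set1.
  apply: negligibleS (negligibleU aeP n01).
  move=> x [nPx]; rewrite /= in_itv/= => /andP[x0 x1].
  have [->|xn0] := eqVneq x 0%R; first by right; left.
  have [->|xn1] := eqVneq x 1%R; first by right; right.
  left => /= H; apply: nPx; apply: H.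
  by rewrite in_itv/= !lt_neqAle x0 x1 eq_sym xn0 xn1.
rewrite null_set_integral//.
apply/measurable_EFinP/measurable_funTS; exact: measurable_uniform_pdf.
Qed.

End UniformIntegral.

Section Orthogonality.
Context {R : realType}.
Local Notation mu := (@lebesgue_measure R).
Local Notation unif := (uniform_prob (@lt01 R)).

Lemma cintegrable_cst d (T : measurableType d) (P : probability T R) (c : R[i]) :
  cintegrable P (fun _ => c).
Proof.
by split; apply: finite_measure_integrable_cst.
Qed.

Lemma cintegral_cst d (T : measurableType d) (P : probability T R) (c : R[i]) :
  cintegral P (fun _ => c) = c.
Proof.
by apply: complex_eqP => /=; rewrite Rintegral_cst// [X in fine X]probability_setT/= mulr1.
Qed.

Lemma Rintegral_derive_periodic (F f : R -> R) :
  continuous f -> (forall x : R, is_derive x (1 : R) F (f x)) -> F 1 = F 0 ->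
  \int[unif]_x f x = 0.
Proof.
move=> cf dF F01; rewrite /Rintegral integral_uniform01; last first.
  by apply/measurable_EFinP; exact: continuous_measurable_fun.
rewrite (@continuous_FTC2 _ f F)//.
- by rewrite F01 subee.
- exact: continuous_subspaceT.
- have cF : continuous F.
    by move=> x; apply/differentiable_continuous/derivable1_diffP; have [] := dF x.
  split => //.
  + by apply: cvg_at_right_filter; exact: cF.
  + by apply: cvg_at_left_filter; exact: cF.
- by move=> x _; rewrite derive1E; exact: derive_val.
Qed.

Lemma cintegral_expi (m : int) :
  cintegral unif (fun t => expi (2 * pi * (m%:~R * t))) = (m == 0)%:R.
Proof.
have [->|m0] := eqVneq m 0.
  under [X in cintegral _ X]funext do rewrite mul0r mulr0 expi0.
  by rewrite cintegral_cst.
pose c : R := 2 * pi * m%:~R.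
have c0 : c != 0 by rewrite !mulf_neq0// ?intr_eq0// gt_eqF// pi_gt0.
under [X in cintegral _ X]funext do rewrite mulrA -/c.
have cc : cos c = 1 := congr1 (fun z => Re z) (expi_int m).
have sc : sin c = 0 := congr1 (fun z => Im z) (expi_int m).
apply: complex_eqP => /=.
- apply: (@Rintegral_derive_periodic (fun t => c^-1 * sin (c * t))).
  + move=> x; apply: continuous_comp; last exact: continuous_cos.
    by apply: mulrl_continuous.
  + move=> x; apply: is_derive_eq; rewrite /GRing.scale/= !mulr1.
    by rewrite mulrCA mulVf// mulr1.
  + by rewrite mulr1 mulr0 sin0 sc.
- apply: (@Rintegral_derive_periodic (fun t => - c^-1 * cos (c * t))).
  + move=> x; apply: continuous_comp; last exact: continuous_sin.
    by apply: mulrl_continuous.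
  + move=> x; apply: is_derive_eq; rewrite /GRing.scale/= !mulr1.
    by rewrite !mulNr mulrN opprK mulrCA mulVf// mulr1.
  + by rewrite mulr1 mulr0 cos0 cc.
Qed.

End Orthogonality.

(** * Trigonometric polynomials *)

Section SmoothStep.
Context {R : realType}.
Implicit Types (x y : R) (n N : nat).

(* The approximate step functions of Brosowski and Deutsch. *)
Definition step_poly n x : R := (1 - x ^+ n) ^+ (2 ^ n).

Lemma bernoulli_ineq N y : -1 <= y -> 1 + N%:R * y <= (1 + y) ^+ N.
Proof.
move=> y1; elim: N => [|N IH]; first by rewrite mul0r addr0 expr0.
rewrite exprS; apply: le_trans (ler_wpM2l _ IH); last lra.
rewrite -natr1; have := sqr_ge0 y; have : 0 <= N%:R :> R by [].
by move: (N%:R : R) => M; nra.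
Qed.

Lemma step_poly_ge0 n x : 0 <= x <= 1 -> 0 <= step_poly n x.
Proof. by case/andP=> x0 x1; rewrite exprn_ge0// subr_ge0 exprn_ile1. Qed.

Lemma step_poly_le1 n x : 0 <= x <= 1 -> step_poly n x <= 1.
Proof.
case/andP=> x0 x1; rewrite exprn_ile1 ?subr_ge0 ?exprn_ile1//.
by rewrite gerBl exprn_ge0.
Qed.

(** Bernoulli's inequality gives [1 - step_poly n x <= (2 * x) ^+ n], a geometric sequence of ratio
    less than 1. *)
Lemma step_poly_lt x : 0 <= x < 1 / 2 -> step_poly ^~ x @ \oo --> (1 : R).
Proof.
case/andP=> x0 x2; have x1 : x <= 1 by lra.
apply: (@squeeze_cvgr _ _ _ _ (fun n => 1 - geometric 1 (2 * x) n) (fun=> 1)).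
- apply: nearW => n /=; rewrite step_poly_le1 ?x0//= andbT.
  have := @bernoulli_ineq (2 ^ n) (- x ^+ n); rewrite lerN2 exprn_ile1// => /(_ isT).
  apply: le_trans; rewrite mul1r exprMn mulrN natrX //.
- rewrite -[X in _ --> X]subr0; apply: cvgB; first exact: cvg_cst.
  by apply: cvg_geometric; rewrite ger0_norm; lra.
- exact: cvg_cst.
Qed.

(** Bernoulli's inequality gives [(2 * x) ^+ n <= (1 + x ^+ n) ^+ (2 ^ n)]. Multiplied by
    [step_poly n x], the right side becomes a power of [1 - x ^+ (2 * n)], hence at most 1; so
    [step_poly n x] is at most [(2 * x)^-1 ^+ n]. *)
Lemma step_poly_gt x : 1 / 2 < x <= 1 -> step_poly ^~ x @ \oo --> (0 : R).
Proof.
case/andP=> x2 x1; have x0 : 0 <= x by lra.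
apply: (@squeeze_cvgr _ _ _ _ (fun=> 0) (fun n => geometric 1 (2 * x)^-1 n)).
- apply: nearW => n /=; rewrite step_poly_ge0 ?x0//= mul1r exprVn.
  have p0 : 0 < (2 * x) ^+ n by rewrite exprn_gt0; lra.
  rewrite -div1r ler_pdivlMr//.
  have xn : 0 <= x ^+ n <= 1 by rewrite exprn_ge0// exprn_ile1.
  have b : (2 * x) ^+ n <= (1 + x ^+ n) ^+ (2 ^ n).
    apply: le_trans (bernoulli_ineq _ _); last by lra.
    by rewrite exprMn natrX lerDr.
  apply: le_trans (ler_wpM2l (step_poly_ge0 _ _) b) _; first by rewrite x0.
  rewrite /step_poly -exprMn exprn_ile1//.
    by case/andP: xn; nra.
  by case/andP: xn; nra.
- exact: cvg_cst.
- apply: cvg_geometric; rewrite ger0_norm ?invr_ge0; last lra.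
  by rewrite invf_lt1; lra.
Qed.

End SmoothStep.

Lemma sum_le_esum (R : realType) (I : choiceType) (s : seq I) (S : set I) (a : I -> \bar R) :
  uniq s -> {in s, forall i, S i} -> (\sum_(i <- s) a i <= \esum_(i in S) a i)%E.
Proof.
move=> us sS; apply: esum_ge; exists [set` s].
  by split; [exact: finite_seq|move=> i /=; exact: sS].
by rewrite fsbig_seq.
Qed.

Section TrigPolynomial.
Context {R : realType}.
Local Notation unif := (uniform_prob (@lt01 R)).
Implicit Types (h : R -> R[i]) (p : {poly R[i]}) (t : R).

(** The domain is [R] and not [Td R 1], which is [unit * R], so that this applies directly to
    sections [t => h (x, t)]. *)
Definition fcoef1 h (m : int) : R[i] :=
  cintegral unif (fun t => h t * expi (- (2 * pi * (m%:~R * t)))).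

(* Writing a trigonometric polynomial as a shifted ordinary polynomial in
   [expi (2 * pi * t)] keeps the frequencies distinct and makes stability under
   powers immediate. *)
Definition trigpoly (N : nat) p t : R[i] :=
  expi (- (2 * pi * (N%:R * t))) * p.[expi (2 * pi * t)].

Lemma trigpolyE N p t :
  trigpoly N p t = \sum_(i < size p) p`_i * expi (- (2 * pi * ((N%:Z - i%:Z)%:~R * t))).
Proof.
rewrite /trigpoly horner_coef mulr_sumr; apply: eq_bigr => i _.
rewrite mulrCA expiX -expiD; congr (_ * expi _).
by rewrite intrB -mulr_natr; ring.
Qed.

Lemma cmeasurable_wave (m : int) : cmeasurable (fun t : R => expi (- (2 * pi * (m%:~R * t)))).
Proof.
apply: cmeasurable_expi; apply: measurableT_comp => //.
by do 2 apply: measurable_funM => //.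
Qed.

Lemma cintegrable_wave h (m : int) : cintegrable unif h ->
  cintegrable unif (fun t => h t * expi (- (2 * pi * (m%:~R * t)))).
Proof.
move=> hi; apply: (@cintegrable_bounded _ _ _ _ _ _ 1) => //.
  exact: cmeasurable_wave.
by move=> t; rewrite normc_expi.
Qed.

Lemma cintegral_trigpoly h N p : cintegrable unif h ->
  cintegrable unif (fun t => h t * trigpoly N p t) /\
  cintegral unif (fun t => h t * trigpoly N p t) =
  \sum_(i < size p) p`_i * fcoef1 h (N%:Z - i%:Z).
Proof.
move=> hi.
have E t : h t * trigpoly N p t =
    \sum_(i < size p) p`_i * (h t * expi (- (2 * pi * ((N%:Z - i%:Z)%:~R * t)))).
  by rewrite trigpolyE mulr_sumr; apply: eq_bigr => i _; rewrite mulrCA.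
under [X in cintegrable _ X]funext do rewrite E.
under [X in cintegral _ X]funext do rewrite E.
have Fi (i : 'I_(size p)) : cintegrable unif
    (fun t => p`_i * (h t * expi (- (2 * pi * ((N%:Z - i%:Z)%:~R * t))))).
  by apply: cintegrableZ; exact: cintegrable_wave.
split; first exact: cintegrable_sum.
rewrite cintegral_sum//; apply: eq_bigr => i _; rewrite cintegralZ//.
exact: cintegrable_wave.
Qed.

Lemma coef_trigpoly N p (j : 'I_(size p)) :
  p`_j = cintegral unif (fun t => expi (2 * pi * ((N%:Z - j%:Z)%:~R * t)) * trigpoly N p t).
Proof.
have wi : cintegrable unif (fun t : R => expi (2 * pi * ((N%:Z - j%:Z)%:~R * t))).
  apply: cintegrableP; last first.
    under [X in integrable _ _ X]funext do rewrite normc_expi.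
    exact: finite_measure_integrable_cst.
  by apply: cmeasurable_expi; do 2 apply: measurable_funM => //.
have [_ ->] := cintegral_trigpoly N p wi.
rewrite (bigD1 j)//= big1 ?addr0 => [|i ij]; rewrite /fcoef1.
  under [X in cintegral _ X]funext do rewrite mulrC expiNK.
  by rewrite cintegral_cst mulr1.
have E t : expi (2 * pi * ((N%:Z - j%:Z)%:~R * t)) * expi (- (2 * pi * ((N%:Z - i%:Z)%:~R * t)))
    = expi (2 * pi * ((i%:Z - j%:Z)%:~R * t)).
  by rewrite -expiD; congr expi; rewrite !intrB; ring.
under [X in cintegral _ X]funext do rewrite E.
rewrite cintegral_expi subr_eq0 eqz_nat.
by rewrite (_ : (_ == _ :> nat) = false) ?mulr0//; exact: negbTE.
Qed.

(* Each coefficient of [trigpoly N p] is at most its L1 norm. *)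
Lemma cintegral_trigpoly_le h N p (M : R) : cintegrable unif h ->
  (\esum_(m in setT) (normc (fcoef1 h m))%:E <= M%:E)%E ->
  normc (cintegral unif (fun t => h t * trigpoly N p t)) <=
  M * \int[unif]_t normc (trigpoly N p t).
Proof.
move=> hi hM; have [_ ->] := cintegral_trigpoly N p hi.
set A := \int[unif]_t _.
have wi : cintegrable unif (trigpoly N p).
  have [] := cintegral_trigpoly N p (cintegrable_cst unif 1).
  by under [X in cintegrable _ X]funext do rewrite mul1r.
have pA (i : 'I_(size p)) : normc p`_i <= A.
  rewrite (coef_trigpoly N); apply: le_trans (normc_cintegral _) _.
    under [X in cintegrable _ X]funext do rewrite mulrC.
    apply: (@cintegrable_bounded _ _ _ _ _ _ 1) => //.
      by apply: cmeasurable_expi; do 2 apply: measurable_funM => //.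
    by move=> t; rewrite normc_expi.
  by under eq_Rintegral do rewrite Normc.normcM normc_expi mul1r.
apply: le_trans (normc_sum _ _) _.
have A0 : 0 <= A by apply: Rintegral_ge0 => t _; exact: normc_ge0.
apply: (@le_trans _ _ (\sum_(i < size p) A * normc (fcoef1 h (N%:Z - i%:Z)))).
  by apply: ler_sum => i _; rewrite Normc.normcM ler_wpM2r ?normc_ge0.
rewrite -mulr_sumr mulrC ler_wpM2r// -lee_fin; apply: le_trans hM.
rewrite -sumEFin.
(* Reindexed by the frequencies [N - i], which are pairwise distinct, the finite sum is part of the
   sum over all integers. *)
rewrite -(big_map (fun i : 'I_(size p) => N%:Z - i%:Z) xpredT (fun m => (normc (fcoef1 h m))%:E)).
apply: sum_le_esum => //.
rewrite map_inj_uniq ?index_enum_uniq// => i j /addrI/oppr_inj [] ij.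
exact: val_inj.
Qed.

End TrigPolynomial.

Section Arc.
Context {R : realType}.
Implicit Types (a b t : R).

(* Less than 1/2 on ]a, b[ and greater than 1/2 on the rest of ]0, 1[. It has
   period 1 in [t], although each sine has period 2: see [arc_cosE]. *)
Definition arc a b t : R := 1 / 2 - (sin (pi * (t - a)) * sin (pi * (b - t))) / 2.

Lemma arc_cosE a b t :
  arc a b t = 1 / 2 + cos (pi * (b - a)) / 4 - cos (2 * pi * t - pi * (a + b)) / 4.
Proof.
have -> : pi * (b - a) = pi * (t - a) + pi * (b - t) by ring.
have -> : 2 * pi * t - pi * (a + b) = pi * (t - a) - pi * (b - t) by ring.
by rewrite cosD cosB /arc; field.
Qed.

Lemma arc_itv a b t : 0 <= arc a b t <= 1.
Proof.
rewrite /arc; set s1 := sin _; set s2 := sin _.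
have h1 : s1 ^+ 2 <= 1 by rewrite -(cos2Dsin2 (pi * (t - a))) lerDr sqr_ge0.
have h2 : s2 ^+ 2 <= 1 by rewrite -(cos2Dsin2 (pi * (b - t))) lerDr sqr_ge0.
by nra.
Qed.

Let sin_pi_gt0 t : 0 < t < 1 -> 0 < sin (pi * t).
Proof.
case/andP=> t0 t1; apply: sin_gt0_pi; have := pi_gt0 R => p0.
by rewrite mulr_gt0//= gtr_pMr.
Qed.

(** Here [t - a] and [b - t] both lie in ]0, 1[, so both sines are positive. In [arc_gt] exactly one
    of the two differences is negative, and the product of the sines changes sign. *)
Lemma arc_lt a b t : 0 <= a -> b <= 1 -> a < t < b -> 0 <= arc a b t < 1 / 2.
Proof.
move=> a0 b1 /andP[at_ tb]; have /andP[-> _] := arc_itv a b t.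
rewrite /arc; have := @sin_pi_gt0 (t - a); have := @sin_pi_gt0 (b - t).
have -> : 0 < b - t < 1 by lra.
have -> : 0 < t - a < 1 by lra.
by move=> /(_ isT) s2 /(_ isT) s1 /=; nra.
Qed.

Lemma arc_gt a b t : 0 <= a -> a < b -> b <= 1 -> 0 < t < 1 -> t < a \/ b < t ->
  1 / 2 < arc a b t <= 1.
Proof.
move=> a0 ab b1 /andP[t0 t1] H; have /andP[_ ->] := arc_itv a b t.
rewrite andbT /arc; case: H => H.
- have := @sin_pi_gt0 (a - t); have := @sin_pi_gt0 (b - t).
  have -> : 0 < b - t < 1 by lra.
  have -> : 0 < a - t < 1 by lra.
  move=> /(_ isT) s2 /(_ isT) s1.
  by rewrite (_ : t - a = - (a - t)) ?mulrN ?sinN; [nra|ring].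
- have := @sin_pi_gt0 (t - a); have := @sin_pi_gt0 (t - b).
  have -> : 0 < t - a < 1 by lra.
  have -> : 0 < t - b < 1 by lra.
  move=> /(_ isT) s2 /(_ isT) s1.
  by rewrite (_ : b - t = - (t - b)) ?mulrN ?sinN; [nra|ring].
Qed.

Definition arc_step a b n t : R := step_poly n (arc a b t).

Let cosC (s : R) : (cos s)%:C%C = (expi s + expi (- s)) / 2.
Proof.
have n2 : (2 : R[i]) != 0 by rewrite pnatr_eq0.
apply: (mulIf n2); rewrite divfK// mulr_natr mulr2n.
by apply: complex_eqP; rewrite /expi cosN sinN /= ?subrr ?addr0.
Qed.

Lemma arc_trigpoly a b : exists p : {poly R[i]}, forall t, (arc a b t)%:C%C = trigpoly 1 p t.
Proof.
pose c : R := 1 / 2 + cos (pi * (b - a)) / 4.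
pose w := expi (pi * (a + b)).
(* With [e = expi (2 * pi * t)], the cosine in [arc_cosE] is half of [e * w^-1 + e^-1 * w]; the
   factor 1/4 turns the half into 1/8, and multiplication by [e] compensates the shift [N = 1]. *)
exists (c%:C%C *: 'X - (8^-1) *: ((expi (- (pi * (a + b)))) *: 'X^2 + w%:P)) => t.
rewrite /trigpoly (_ : 1%:R * t = t) ?mul1r// !hornerE arc_cosE -/c.
set e := expi (2 * pi * t).
rewrite rmorphB/= rmorphM/= cosC expiD opprB expiD -/e -/w.
set e' := expi (- (2 * pi * t)); set w' := expi (- _).
have ee : e' * e = 1 by exact: expiNK.
have -> : (4^-1)%:C%C = 4^-1 :> R[i] by rewrite fmorphV/= rmorph_nat.
have -> : e' * (c%:C%C * e - 8^-1 * (w' * e * e + w)) =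
   c%:C%C * (e' * e) - 8^-1 * (w' * e * (e' * e) + w * e') by ring.
by rewrite ee; field.
Qed.

Lemma arc_step_trigpoly a b n : exists N (p : {poly R[i]}),
  forall t, (arc_step a b n t)%:C%C = trigpoly N p t.
Proof.
have [p pE] := arc_trigpoly a b.
(* Since [arc] is [e' * p.[e]] with [e' * e = 1], one has [1 - arc ^+ n = e' ^+ n * (e ^+ n - p.[e]
   ^+ n)]; the outer power multiplies the shift [n] by [2 ^ n]. *)
exists (n * 2 ^ n)%N, (('X^n - p ^+ n) ^+ (2 ^ n)) => t.
rewrite /arc_step /step_poly rmorphXn rmorphB rmorph1 rmorphXn/= pE /trigpoly.
set e := expi (2 * pi * t); set e' := expi (- (2 * pi * (1%:R * t))).
have -> : expi (- (2 * pi * ((n * 2 ^ n)%:R * t))) = (e' ^+ n) ^+ (2 ^ n).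
  rewrite -exprM expiX -mulr_natr; congr expi; ring.
rewrite horner_exp hornerD hornerN !horner_exp hornerX -exprMn; congr (_ ^+ _).
by rewrite mulrBr -!exprMn /e' mul1r expiNK expr1n.
Qed.

Lemma measurable_arc_step a b n : measurable_fun setT (arc_step a b n).
Proof.
apply: measurable_funX; apply: measurable_funB => //; apply: measurable_funX.
apply: measurable_funB => //; apply: measurable_funM => //; apply: measurable_funM.
- apply: (measurableT_comp (measurable_funTS _)) => //.
    by apply: continuous_measurable_fun; exact: continuous_sin.
  by apply: measurable_funM => //; exact: measurable_funB.
- apply: (measurableT_comp (measurable_funTS _)) => //.
    by apply: continuous_measurable_fun; exact: continuous_sin.
  by apply: measurable_funM => //; exact: measurable_funB.
Qed.

End Arc.

(** * From Fourier coefficients to intervals, and from intervals to points *)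

Section IntervalBound.
Context {R : realType}.
Local Notation mu := (@lebesgue_measure R).
Local Notation unif := (uniform_prob (@lt01 R)).

Lemma cvg_Rintegral_arc_step (f : R -> R) (a b : R) :
  unif.-integrable setT (EFin \o f) -> 0 <= a -> a < b -> b <= 1 ->
  (fun n => \int[unif]_t (f t * arc_step a b n t)) @ \oo --> \int[mu]_(t in `]a, b]) f t.
Proof.
move=> fi a0 ab b1.
have mf : measurable_fun setT f by apply/measurable_EFinP; exact: measurable_int fi.
have mfab : measurable_fun setT (f \_ `]a, b]).
  apply/(measurable_restrictT _ _).1 => //; exact: measurable_funTS.
have -> : \int[mu]_(t in `]a, b]) f t = \int[unif]_t (f \_ `]a, b]) t.
  rewrite {2}/Rintegral integral_uniform01; last exact/measurable_EFinP.
  rewrite -[RHS]/(\int[mu]_(x in `[0, 1]) (f \_ `]a, b]) x) -Rintegral_mkcondr.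
  congr (Rintegral _ _ _).
  apply/esym/setIidPr => t /=; rewrite !in_itv/= => /andP[at_ tb].
  by rewrite (le_trans a0 (ltW at_)) (le_trans tb b1).
have [] // := @dominated_convergence _ _ _ unif setT measurableT
  (fun n t => (f t * arc_step a b n t)%:E) (EFin \o (f \_ `]a, b]))
  (fun t => `|f t|%:E).
- by move=> n; apply/measurable_EFinP/measurable_funM => //; exact: measurable_arc_step.
- exact/measurable_EFinP.
(* At [a] and [b] the value of [arc] is 1/2, the threshold that [step_poly_lt] and [step_poly_gt]
   leave out. *)
- pose P := [set t : R | 0 < t < 1 /\ t != a /\ t != b].
  have mP : measurable P.
    have -> : P = `]0, 1[%classic `\` [set a] `\` [set b].
      apply/seteqP; split => t /=; rewrite in_itv/=.
        by move=> [? [/eqP ? /eqP ?]].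
      by move=> [[? /eqP ?] /eqP ?].
    by apply: measurableD => //; exact: measurableD.
  have aeP : {ae unif, forall t, P t}.
    apply: ae_uniform01 => //.
    have na (c : R) : {ae mu, forall t : R, t != c}.
      exists [set c]; split => //; first exact: lebesgue_measure_set1.
      by move=> t /= /negP; rewrite negbK => /eqP.
    apply: (@filterS2 _ _ (ae_filter_ringOfSetsType mu) _ _ _ _ (na a) (na b)) => t ta tb /=; rewrite in_itv/= => t01.
    by split.
  apply: (@filterS _ _ (ae_filter_ringOfSetsType unif) _ _ _ aeP) => t [t01 [ta tb]] _.
  apply: cvg_EFin; first exact: nearW.
  rewrite /comp/= patchE.
  case: ifPn => [|]; rewrite ?notin_setE ?inE/= in_itv/=.
  + move=> /andP[at_ tb']; rewrite -[X in _ --> X]mulr1.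
    apply: cvgM; first exact: cvg_cst.
    by apply: step_poly_lt; apply: arc_lt => //; rewrite at_ lt_neqAle tb.
  + move=> nt; rewrite -[X in _ --> X](mulr0 (f t)).
    apply: cvgM; first exact: cvg_cst.
    apply: step_poly_gt; apply: arc_gt => //.
    move: nt; case: (ltP a t) => /= [at_ /negP|ta' _]; last by left; rewrite lt_neqAle ta.
    by rewrite -ltNge; right.
- by move/integrable_abse: fi.
- apply: aeW => t n _; rewrite /= lee_fin normrM ler_piMr//.
  have h := arc_itv a b t.
  by rewrite ger0_norm ?step_poly_ge0 ?step_poly_le1.
move=> iab _ cv; rewrite /Rintegral.
apply: fine_cvg; rewrite fineK//; exact: integrable_fin_num.
Qed.

(** This is the limit of [cintegral_trigpoly_le] along [arc_step a b n]. The L1 norms on the right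
    converge to [b - a] by [cvg_Rintegral_arc_step] with the constant 1. The squared form lets real
    and imaginary parts pass to the limit separately. *)
Lemma normc_integral_itv_le (h : R -> R[i]) (M a b : R) : cintegrable unif h ->
  (\esum_(m in setT) (normc (fcoef1 h m))%:E <= M%:E)%E ->
  0 <= a -> a < b -> b <= 1 ->
  (\int[mu]_(t in `]a, b]) Re (h t)) ^+ 2 + (\int[mu]_(t in `]a, b]) Im (h t)) ^+ 2 <=
  (M * (b - a)) ^+ 2.
Proof.
move=> hi hM a0 ab b1; have [hr him] := hi.
have M0 : 0 <= M by rewrite -lee_fin; apply: le_trans hM; apply: esum_ge0 => m _; rewrite lee_fin normc_ge0.
have c1 := cvg_Rintegral_arc_step (finite_measure_integrable_cst unif 1 measurableT) a0 ab b1.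
have cr := cvg_Rintegral_arc_step hr a0 ab b1.
have ci := cvg_Rintegral_arc_step him a0 ab b1.
have I1 : \int[mu]_(t in `]a, b]) (fun=> 1) t = b - a.
  rewrite Rintegral_cst//= lebesgue_measure_itv/= lte_fin ab mul1r.
  by [].
rewrite I1 in c1.
have cM : (fun n => M * \int[unif]_t (cst 1 t * arc_step a b n t)) @ \oo --> M * (b - a).
  exact: cvgM (cvg_cst M) c1.
rewrite !expr2; apply: ler_cvg_to (cvgD (cvgM cr cr) (cvgM ci ci)) (cvgM cM cM) _.
apply: nearW => n /=; rewrite -!expr2.
have [N [p pE]] := arc_step_trigpoly a b n.
have := cintegral_trigpoly_le N p hi hM.
have -> : \int[unif]_t normc (trigpoly N p t) = \int[unif]_t (1 * arc_step a b n t).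
  apply: eq_Rintegral => t _; rewrite -pE mul1r /= expr0n/= addr0 sqrtr_sqr ger0_norm//.
  by apply: step_poly_ge0; exact: arc_itv.
have I0 : 0 <= M * \int[unif]_t (1 * arc_step a b n t).
  rewrite mulr_ge0//; apply: Rintegral_ge0 => t _; rewrite mul1r.
  by apply: step_poly_ge0; exact: arc_itv.
rewrite -ler_sqr ?nnegrE ?normc_ge0// sqr_normcE; apply: le_trans.
rewrite le_eqVlt; apply/orP; left; apply/eqP.
congr (_ ^+ 2 + _ ^+ 2).
- by apply: eq_Rintegral => t _; rewrite -pE ReM /= mulr0 subr0.
- by apply: eq_Rintegral => t _; rewrite -pE ImM /= mulr0 add0r.
Qed.

End IntervalBound.

Section Wiener1.
Context {R : realType}.
Local Notation mu := (@lebesgue_measure R).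
Local Notation unif := (uniform_prob (@lt01 R)).

(* Lebesgue differentiation turns the bounds on the integrals over intervals
   into a pointwise bound. *)
Lemma ae_normc_le_fcoef1 (h : R -> R[i]) (M : R) : cintegrable unif h ->
  (\esum_(m in setT) (normc (fcoef1 h m))%:E <= M%:E)%E ->
  {ae unif, forall t, normc (h t) <= M}.
Proof.
move=> hi hM; have [hr him] := hi.
have [mr mi] := cintegrable_measurable hi.
have M0 : 0 <= M.
  by rewrite -lee_fin; apply: le_trans hM; apply: esum_ge0 => m _; rewrite lee_fin normc_ge0.
apply: ae_uniform01.
  rewrite -[X in measurable X]setTI.
  by apply: measurable_fun_le => //; exact: cmeasurable_normc.
have key (f : R -> R) : unif.-integrable setT (EFin \o f) -> measurable_fun setT f ->
    {ae mu, forall t : R, 0 < t < 1 ->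
      (fun s => s^-1 * \int[mu]_(u in `]t, s + t]) f u) @ 0^'+ --> f t}.
  move=> fi mf.
  have fi01 : mu.-integrable `[0, 1] (EFin \o f).
    by apply/integrable_uniform01 => //; exact/measurable_EFinP.
  (* The fundamental theorem is applied to the extension of [f] by zero, which is integrable on the
     whole line and equals [f] on ]0, 1[. *)
  have fiT : mu.-integrable setT (EFin \o (f \_ `[0, 1])).
    by rewrite -restrict_EFin -integrable_mkcond.
  have loc := @integrable_locally _ f `[0, 1] (measurable_itv _) fi01.
  have fiS (A : set R) : measurable A -> mu.-integrable A (EFin \o (f \_ `[0, 1])).
    by move=> mA; apply: integrableS fiT.
  have := FTC1Ny (fun y => fiS _ (measurable_itv _)) loc.
  apply: (@filterS _ _ (ae_filter_ringOfSetsType mu)) => t [dF F't] /andP[t0 t1].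
  set F := (fun x => _) in dF F't.
  have : (fun s : R => s^-1 *: ((F \o shift t) (s *: (1 : R)) - F t)) @ 0^' --> f t.
    have -> : f t = derive1 F t.
      by rewrite F't patchE mem_set//= in_itv/= !ltW.
    by rewrite derive1E; exact: dF.
  (* The right difference quotient suffices: for [s < 1 - t] it averages over []t, s + t]], which
     stays inside [0, 1]. *)
  move=> /cvg_dnbhs_at_right; apply: cvg_trans; apply: near_eq_cvg.
  near=> s.
  have s0 : 0 < s by near: s; exact: nbhs_right_gt.
  have s1 : s < 1 - t by near: s; apply: nbhs_right_lt; rewrite subr_gt0.
  rewrite /GRing.scale/= mulr1; congr (_ * _).
  rewrite /F Rintegral_itvB//.
  - apply: eq_Rintegral => u; rewrite inE/= in_itv/= => /andP[tu us].
    rewrite patchE mem_set//= in_itv/=; apply/andP; split; lra.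
  - exact: fiS.
  - by rewrite bnd_simp lerDr ltW.
apply: (@filterS2 _ _ (ae_filter_ringOfSetsType mu) _ _ _ _ (key _ hr mr) (key _ him mi)).
move=> t kr ki; rewrite /= in_itv/= => t01.
have {}kr := kr t01; have {}ki := ki t01.
case/andP: t01 => t0 t1.
apply: normc_le => //.
rewrite !expr2; apply: ler_cvg_to (cvgD (cvgM kr kr) (cvgM ki ki)) (cvg_cst (M * M)) _.
near=> s.
have s0 : 0 < s by near: s; exact: nbhs_right_gt.
have s1 : s < 1 - t by near: s; apply: nbhs_right_lt; rewrite subr_gt0.
have := @normc_integral_itv_le _ h M t (s + t) hi hM.
have -> : 0 <= t by exact: ltW.
have -> : t < s + t by rewrite ltrDr.
have -> : s + t <= 1 by rewrite -lerBrDr ltW.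
move=> /(_ isT isT isT); rewrite addrK.
set A := \int[mu]_(u in _) Re _; set B := \int[mu]_(u in _) Im _ => AB.
rewrite -[leLHS]/(s^-1 * A * (s^-1 * A) + s^-1 * B * (s^-1 * B)).
by rewrite -!expr2 !exprMn -mulrDr exprVn ler_pdivrMl ?exprn_gt0// -exprMn mulrC.
Unshelve. all: by end_near. Qed.

End Wiener1.

(** * Pointwise bound on the torus *)

(** The product measure of the complement of [A] is the integral of the measures of its sections,
    which vanish for almost every [x]. *)
Lemma ae_product d1 d2 (T1 : measurableType d1) (T2 : measurableType d2) (R : realType)
    (m1 : probability T1 R) (m2 : probability T2 R) (A : set (T1 * T2)) :
  measurable A -> {ae m1, forall x, {ae m2, forall y, A (x, y)}} ->
  {ae (m1 \x m2)%E, forall z, A z}.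
Proof.
move=> mA aeA; exists (~` A); split => //; first exact: measurableC.
have mC : measurable (~` A) by exact: measurableC.
rewrite /product_measure1.
transitivity (\int[m1]_x (0 : \bar R))%E; last by rewrite integral0.
apply: ae_eq_integral => //.
  exact: measurable_fun_xsection.
apply: (@filterS _ _ (ae_filter_ringOfSetsType m1) _ _ _ aeA) => x aex _.
apply: measure_negligible; first exact: measurable_xsection.
apply: negligibleS aex => y /=.
by rewrite /xsection /= inE.
Qed.

Lemma ae_eq_cintegral d (T : measurableType d) (R : realType)
    (mu : {measure set T -> \bar R}) (f g : T -> R[i]) :
  cmeasurable f -> cmeasurable g -> {ae mu, forall x, f x = g x} ->
  cintegral mu f = cintegral mu g.
Proof.
move=> [fr fi] [gr gi] fg; apply: complex_eqP => /=; congr fine;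
  apply: ae_eq_integral => //; try exact/measurable_EFinP;
  by apply: (@filterS _ _ (ae_filter_ringOfSetsType mu) _ _ _ fg) => x -> _.
Qed.

Section Wiener.
Context {R : realType}.
Local Notation unif := (uniform_prob (@lt01 R)).

Definition freq_rcons n (k : freq n) (m : int) : freq n.+1 :=
  [ffun j => if unlift ord_max j is Some i then k i else m].

Lemma freq_rcons_bij n : bijective (fun q : int * freq n => freq_rcons q.2 q.1).
Proof.
exists (fun k : freq n.+1 => (k ord_max, [ffun i => k (lift ord_max i)])).
  move=> [m k] /=; congr pair; first by rewrite ffunE unlift_none.
  by apply/ffunP => i; rewrite !ffunE liftK.
move=> k; apply/ffunP => j; rewrite ffunE /=.
by case: unliftP => [i|] ->; rewrite ?ffunE.
Qed.

Lemma kdot_rcons n (k : freq n) (m : int) (x : Td R n) (t : R) :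
  kdot (freq_rcons k m) ((x, t) : Td R n.+1) = kdot k x + m%:~R * t.
Proof.
rewrite /kdot big_ord_recr/= eqxx; congr (_ + _).
  apply: eq_bigr => i _; rewrite ltn_eqF ?ltn_ord//.
  congr (_%:~R * _); rewrite ffunE.
  have -> : widen_ord (leqnSn n) i = lift ord_max i.
    by apply: val_inj; rewrite /= /bump leqNgt ltn_ord.
  by rewrite liftK.
by rewrite ffunE unlift_none.
Qed.

Lemma measurable_tcoord n j : measurable_fun setT (fun x : Td R n => tcoord x j).
Proof.
elim: n => [|n IH]; first exact: measurable_cst.
have IH' := measurableT_comp IH (@measurable_fst _ _ (Td R n) (measurableTypeR R)).
rewrite /=; case: eqP => _; last exact: IH'.
exact: (@measurable_snd _ _ (Td R n) (measurableTypeR R)).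
Qed.

Lemma measurable_kdot n (k : freq n) : measurable_fun setT (fun x : Td R n => kdot k x).
Proof.
apply: measurable_sum => j.
by apply: measurable_funM => //; exact: measurable_tcoord.
Qed.

Lemma cmeasurable_twave n (k : freq n) :
  cmeasurable (fun x : Td R n => expi (- (2 * pi * kdot k x))).
Proof.
apply: cmeasurable_expi; apply: measurableT_comp => //.
by apply: measurable_funM => //; exact: measurable_kdot.
Qed.

Lemma cintegrable_twave n (h : Td R n -> R[i]) (k : freq n) : cintegrable (tlam R n) h ->
  cintegrable (tlam R n) (fun x => h x * expi (- (2 * pi * kdot k x))).
Proof.
move=> hi; apply: (@cintegrable_bounded _ _ _ _ _ _ 1) => //.
  exact: cmeasurable_twave.
by move=> t; rewrite normc_expi.
Qed.

Lemma fcoef_rcons n (h : Td R n.+1 -> R[i]) (k : freq n) (m : int) :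
  cintegrable (tlam R n.+1) h ->
  let H x := fcoef1 (fun t => h (x, t)) m in
  cintegrable (tlam R n) H /\ fcoef h (freq_rcons k m) = fcoef H k.
Proof.
move=> hi H; have HI : cintegrable (tlam R n) H.
  have wi : cintegrable (tlam R n \x unif)%E
      (fun z => h z * expi (- (2 * pi * (m%:~R * z.2)))).
    apply: (@cintegrable_bounded _ _ _ _ _ _ 1) => //.
      apply: cmeasurable_expi; apply: measurableT_comp => //.
      by do 2 apply: measurable_funM => //.
    by move=> t; rewrite normc_expi.
  by have [] := cfubini1 wi.
split => //.
have wi := cintegrable_twave (freq_rcons k m) hi.
have [iF FE] := cfubini1 wi.
rewrite /fcoef; transitivity (cintegral (tlam R n) (fun x => cintegral unif (fun t =>
    h (x, t) * expi (- (2 * pi * kdot (freq_rcons k m) ((x, t) : Td R n.+1))))));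
  first exact: esym FE.
apply: ae_eq_cintegral; first exact: cintegrable_measurable iF.
  exact: cintegrable_measurable (cintegrable_twave k HI).
(* The character of [k] is pulled out of the inner integral where the section [h (x, .)] is
   integrable, that is, for almost every [x]. *)
apply: (@filterS _ _ (ae_filter_ringOfSetsType (tlam R n)) _ _ _ (ae_cintegrable1 hi)) => x hx.
rewrite /H /fcoef1 [RHS]mulrC -cintegralZ; last exact: cintegrable_wave.
apply: eq_cintegral => t; rewrite kdot_rcons mulrDr opprD expiD; ring.
Qed.

(** The bound in dimension one uses all coefficients of one section at once, so the exceptional null
    set must not depend on [m]. *)
Lemma ae_forall_int d (T : measurableType d) (mu : {measure set T -> \bar R})
    (P : int -> T -> Prop) :
  (forall m, {ae mu, forall x, P m x}) -> {ae mu, forall x, forall m, P m x}.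
Proof.
move=> aeP.
have a1 : {ae mu, forall x, forall n, P (Posz n) x} by apply/ae_foralln => n; exact: aeP.
have a2 : {ae mu, forall x, forall n, P (Negz n) x} by apply/ae_foralln => n; exact: aeP.
by apply: (@filterS2 _ _ (ae_filter_ringOfSetsType mu) _ _ _ _ a1 a2) => x p1 p2 [].
Qed.

Lemma ae_normc_le_fcoef n (h : Td R n -> R[i]) (M : R) : cintegrable (tlam R n) h ->
  (\esum_(k in [set: freq n]) (normc (fcoef h k))%:E <= M%:E)%E ->
  {ae tlam R n, forall x, normc (h x) <= M}.
Proof.
elim: n h M => [|n IH] h M hi hM.
  have hE : fcoef h [ffun=> 0] = h tt.
    rewrite /fcoef /kdot; under [X in cintegral _ X]funext do
      rewrite big_ord0 mulr0 oppr0 expi0 mulr1.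
    by apply: complex_eqP; rewrite /= /Rintegral integral_dirac// diracT mul1e.
  apply: aeW => -[]; rewrite -lee_fin; apply: le_trans hM.
  rewrite -hE; apply: esum_ge; exists [set [ffun=> 0]].
    by split => //; exact: finite_set1.
  by rewrite fsbig_set1.
(* The induction hypothesis bounds [H m] almost everywhere by [S m], the sum over the frequencies
   with last entry [m]. The [S m] add up to at most [M], so for almost every [x] the section
   [h (x, .)] satisfies the hypothesis of the bound in dimension one. *)
pose H m x := fcoef1 (fun t => h (x, t)) m.
have HI m : cintegrable (tlam R n) (H m) by have [] := fcoef_rcons [ffun=> 0] m hi.
pose S m := (\esum_(k in [set: freq n]) (normc (fcoef (H m) k))%:E)%E.
have S0 m : (0 <= S m)%E by apply: esum_ge0 => k _; rewrite lee_fin normc_ge0.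
have SM : (\esum_(m in [set: int]) S m <= M%:E)%E.
  apply: le_trans hM; rewrite esum_esum; last by move=> *; rewrite lee_fin normc_ge0.
  have [g gK Kg] := freq_rcons_bij n.
  rewrite (reindex_esum setT setT (fun q : int * freq n => freq_rcons q.2 q.1))//.
  - rewrite le_eqVlt; apply/orP; left; apply/eqP; rewrite (_ : _ `*`` _ = setT).
      apply: eq_esum => -[m k] _.
      have [_ E] := fcoef_rcons k m hi.
      by congr (normc _)%:E; exact: esym E.
    by apply/seteqP; split => // -[].
  - split => //; first by move=> x y _ _ /(can_inj gK).
    by move=> k _; exists (g k).
have Sfin m : S m \is a fin_num.
  rewrite ge0_fin_numE//; apply: le_lt_trans (ltry M); apply: le_trans SM.
  apply: esum_ge; exists [set m]; first by split => //; exact: finite_set1.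
  by rewrite fsbig_set1.
have aeH : {ae tlam R n, forall x, forall m, normc (H m x) <= fine (S m)}.
  by apply: ae_forall_int => m; apply: IH => //; rewrite fineK.
have mA : measurable [set z : Td R n * measurableTypeR R | normc (h z) <= M].
  rewrite -[X in measurable X]setTI.
  apply: measurable_fun_le => //.
  by apply: cmeasurable_normc; exact: cintegrable_measurable hi.
apply: (@ae_product _ _ _ _ _ (tlam R n) unif _ mA).
apply: (@filterS2 _ _ (ae_filter_ringOfSetsType (tlam R n)) _ _ _ _ aeH (ae_cintegrable1 hi)).
move=> x Hx hx; apply: ae_normc_le_fcoef1 => //.
apply: le_trans SM; apply: le_esum => m _.
by rewrite -(fineK (Sfin m)) lee_fin; exact: Hx.
Qed.

End Wiener.

(** * Mixing coordinates *)

Section Mix.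
Context {R : realType}.
Implicit Types (p : nat -> bool) (g : nat -> R).

Lemma eq_tbuild n g g' : (forall j, (j < n)%N -> g j = g' j) -> tbuild n g = tbuild n g'.
Proof.
elim: n => [//|n IH] gg /=; rewrite (IH _) => [|j jn]; last exact/gg/ltnW.
by rewrite gg.
Qed.

Lemma tcoord_build n g j : (j < n)%N -> tcoord (tbuild n g) j = g j.
Proof.
elim: n => [//|n IH]; rewrite ltnS leq_eqVlt /= => /orP[/eqP ->|jn]; first by rewrite eqxx.
by rewrite ltn_eqF// IH.
Qed.

Lemma tbuild_coord n (x : Td R n) : tbuild n (tcoord x) = x.
Proof.
elim: n x => [[]//|n IH] [x t] /=; rewrite eqxx; congr pair.
by rewrite -[RHS]IH; apply: eq_tbuild => j jn; rewrite ltn_eqF.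
Qed.

(** [mixpt u] is the case [p = in_u u]. A predicate on [nat], unlike a subset of ['I_n], stays the
    same when an induction changes [n]. *)
Definition tmix n p (x y : Td R n) : Td R n :=
  tbuild n (fun j => if p j then tcoord x j else tcoord y j).

Lemma tcoord_mix n p (x y : Td R n) j : (j < n)%N ->
  tcoord (tmix p x y) j = if p j then tcoord x j else tcoord y j.
Proof. by move=> jn; rewrite tcoord_build. Qed.

Lemma tmixK n p (x y : Td R n) : tmix p (tmix p x y) (tmix p y x) = x.
Proof.
rewrite -[RHS]tbuild_coord; apply: eq_tbuild => j jn; rewrite !tcoord_mix//.
by case: ifP => [|] ->.
Qed.

Lemma tmixS n p (x y : Td R n) (s t : R) :
  tmix p ((x, s) : Td R n.+1) ((y, t) : Td R n.+1) =
  ((tmix p x y, if p n then s else t) : Td R n.+1).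
Proof.
rewrite /tmix /= !eqxx; congr pair.
by apply: eq_tbuild => j jn; rewrite ltn_eqF.
Qed.

Lemma measurable_tmix n p :
  measurable_fun setT (fun z : Td R n * Td R n => tmix p z.1 z.2).
Proof.
(* The dimension [m] of the point being built is separated from that of [z], which stays fixed
   during the induction. *)
suff H m : measurable_fun setT (fun z : Td R n * Td R n =>
    tbuild m (fun j => if p j then tcoord z.1 j else tcoord z.2 j)) by exact: (H n).
elim: m => [|m IH] /=; first exact: measurable_cst.
apply/measurable_fun_pairP; split => //=.
case: (p m).
  by have := measurableT_comp (@measurable_tcoord R n m) (@measurable_fst _ _ (Td R n) (Td R n)).
by have := measurableT_comp (@measurable_tcoord R n m) (@measurable_snd _ _ (Td R n) (Td R n)).
Qed.

End Mix.

Section Tonelli4.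
Context d1 d2 {T1 : measurableType d1} {T2 : measurableType d2} {R : realType}.
Context (m1 : probability T1 R) (m2 : probability T2 R).
Context (F : (T1 * T2) * (T1 * T2) -> \bar R).
Context (mF : measurable_fun setT F) (F0 : forall z, (0 <= F z)%E).
Local Open Scope ereal_scope.

(** Integrating out both last coordinates leaves a function of a pair of points one dimension lower,
    to which the induction in [tonelli_mix] applies. *)
Definition fiber_integral (z : T1 * T1) : \bar R :=
  \int[m2]_s \int[m2]_t F ((z.1, s), (z.2, t)).

Let mF4 : measurable_fun setT
  (fun q : ((T1 * T1) * T2) * T2 => F ((q.1.1.1, q.1.2), (q.1.1.2, q.2))).
Proof.
apply: (measurableT_comp mF).
by apply: measurable_fun_pair; apply: measurable_fun_pair => //;
  repeat (apply: measurableT_comp => //).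
Qed.

Let mF3 : measurable_fun setT
  (fun q : (T1 * T1) * T2 => \int[m2]_t F ((q.1.1, q.2), (q.1.2, t))).
Proof. exact: (measurable_fun_fubini_tonelli_F (m2 := m2) _ mF4 (fun q => F0 _)). Qed.

Lemma measurable_fiber_integral : measurable_fun setT fiber_integral.
Proof.
apply: (measurable_fun_fubini_tonelli_F (m2 := m2) _ mF3) => z.
exact: integral_ge0.
Qed.

Let m12 : probability (T1 * T2)%type R := (m1 \x m2)%E.

(** The left side integrates in the order [x, s, y, t] and the right side in the order [x, y, s, t]:
    Tonelli is used to exchange [s] and [y]. *)
Lemma tonelli4 :
  \int[m12]_z \int[m12]_w F (z, w) = \int[m1]_x \int[m1]_y fiber_integral (x, y).
Proof.
have mG : measurable_fun setT (fun z => \int[m12]_w F (z, w)).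
  exact: (@measurable_fun_fubini_tonelli_F _ _ _ _ _ m12 F mF F0).
transitivity (\int[m1]_x \int[m2]_s \int[m12]_w F ((x, s), w)).
  apply: (@fubini_tonelli1 _ _ _ _ _ m1 m2 (fun z => \int[m12]_w F (z, w)) mG) => z.
  exact: integral_ge0.
apply: eq_integral => x _.
transitivity (\int[m2]_s \int[m1]_y \int[m2]_t F ((x, s), (y, t))).
  apply: eq_integral => s _.
  apply: (@fubini_tonelli1 _ _ _ _ _ m1 m2 (fun w => F ((x, s), w))) => //.
  exact: measurable_fun_pair2.
have mx : measurable_fun setT (fun q : T1 * T2 => ((x, q.1), q.2)).
  by apply: measurable_fun_pair => //; exact: measurable_fun_pair.
apply/esym; apply: (@fubini_tonelli _ _ _ _ _ m1 m2
  (fun q : T1 * T2 => \int[m2]_t F ((x, q.2), (q.1, t)))) => [|z].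
- exact: (measurableT_comp mF3 mx).
- exact: integral_ge0.
Qed.

End Tonelli4.

Section MixInvariance.
Context {R : realType}.
Local Notation unif := (uniform_prob (@lt01 R)).

Definition tmix2 n p (z : Td R n * Td R n) : Td R n * Td R n :=
  (tmix p z.1 z.2, tmix p z.2 z.1).

Lemma measurable_tmix2 n p : measurable_fun setT (@tmix2 n p).
Proof.
apply: measurable_fun_pair; first exact: measurable_tmix.
apply: (measurableT_comp (@measurable_tmix R n p)
  (_ : measurable_fun setT (fun z : Td R n * Td R n => (z.2, z.1)))).
by apply: measurable_fun_pair.
Qed.

Local Open Scope ereal_scope.

Lemma tonelli_mix n p (F : Td R n * Td R n -> \bar R) :
  measurable_fun setT F -> (forall z, 0 <= F z) ->
  \int[tlam R n]_x \int[tlam R n]_y F (x, y) =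
  \int[tlam R n]_x \int[tlam R n]_y F (tmix2 p (x, y)).
Proof.
elim: n F => [|n IH] F mF F0.
  by apply: eq_integral => -[] _; apply: eq_integral => -[] _.
have mF' : measurable_fun setT (F \o tmix2 p).
  exact: (measurableT_comp mF (@measurable_tmix2 n.+1 p)).
have L := @tonelli4 _ _ _ _ _ (tlam R n) unif F mF F0.
have L' := @tonelli4 _ _ _ _ _ (tlam R n) unif (F \o tmix2 p) mF' (fun z => F0 _).
have mK := @measurable_fiber_integral _ _ _ _ _ unif F mF F0.
apply: (eq_trans L); apply/esym; apply: (eq_trans L'); apply/esym.
have K0 z : 0 <= fiber_integral unif F z.
  by apply: integral_ge0 => s _; exact: integral_ge0.
apply: (eq_trans (IH _ mK K0)).
apply: eq_integral => x _; apply: eq_integral => y _.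
rewrite /fiber_integral /=.
have E s t : tmix2 p (((x, s), (y, t)) : Td R n.+1 * Td R n.+1) =
    (((tmix p x y, if p n then s else t), (tmix p y x, if p n then t else s))
      : Td R n.+1 * Td R n.+1).
  by rewrite /tmix2 /= !tmixS.
transitivity (\int[unif]_s \int[unif]_t
  F ((tmix p x y, if p n then s else t), (tmix p y x, if p n then t else s))); last first.
  by apply: eq_integral => s _; apply: eq_integral => t _; congr (F _); exact: esym (E s t).
(* If [p n] holds, the last coordinates stay in place. Otherwise they are exchanged, and Tonelli on
   the square undoes this. *)
case: (p n) => //.
apply: (@fubini_tonelli _ _ _ _ _ unif unif
  (fun q : R * R => F ((tmix p x y, q.1), (tmix p y x, q.2)))) => [|z]; last exact: F0.
apply: (measurableT_comp mF).
by apply: measurable_fun_pair; apply: measurable_fun_pair.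
Qed.

End MixInvariance.

Section MixFubini.
Context {R : realType} (n : nat) (p : nat -> bool).
Local Notation lam := (tlam R n).

Let lam2 : probability (Td R n * Td R n)%type R := (lam \x lam)%E.

Let integral_mix_ge0 (F : Td R n * Td R n -> \bar R) :
  measurable_fun setT F -> (forall z, 0 <= F z)%E ->
  (\int[lam2]_z F z = \int[lam2]_z F (tmix2 p z))%E.
Proof.
move=> mF F0.
have mF' := measurableT_comp mF (measurable_tmix2 p).
have L := @fubini_tonelli1 _ _ _ _ _ lam lam F mF F0.
have L' := @fubini_tonelli1 _ _ _ _ _ lam lam (F \o tmix2 p) mF' (fun z => F0 _).
exact: (eq_trans L (eq_trans (tonelli_mix p mF F0) (esym L'))).
Qed.

Let integral_mix (F : Td R n * Td R n -> \bar R) :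
  measurable_fun setT F -> (\int[lam2]_z F z = \int[lam2]_z F (tmix2 p z))%E.
Proof.
move=> mF; rewrite integralE [RHS]integralE.
congr (_ - _)%E.
- by rewrite (integral_mix_ge0 (measurable_funepos mF))//; apply: eq_integral => z _; rewrite ?funeposE ?funenegE.
- by rewrite (integral_mix_ge0 (measurable_funeneg mF))//; apply: eq_integral => z _; rewrite ?funeposE ?funenegE.
Qed.

Let integrable_mix (F : Td R n * Td R n -> \bar R) :
  lam2.-integrable setT F -> lam2.-integrable setT (F \o tmix2 p).
Proof.
move=> /integrableP[mF iF]; apply/integrableP; split.
  exact: measurableT_comp mF (measurable_tmix2 p).
have mA : measurable_fun setT (fun z => `|F z|)%E by exact: measurableT_comp.
by rewrite -(integral_mix_ge0 mA).
Qed.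

Lemma cintegrable_mix (F : Td R n * Td R n -> R[i]) :
  cintegrable (lam \x lam)%E F -> cintegrable (lam \x lam)%E (F \o tmix2 p).
Proof. by move=> [fr fi]; split; [exact: integrable_mix fr|exact: integrable_mix fi]. Qed.

Lemma cintegral_mix (F : Td R n * Td R n -> R[i]) :
  cintegrable (lam \x lam)%E F ->
  cintegral (lam \x lam)%E (F \o tmix2 p) = cintegral (lam \x lam)%E F.
Proof.
move=> [/measurable_int mr /measurable_int mi].
by apply: complex_eqP; congr fine; apply/esym; [exact: integral_mix mr|exact: integral_mix mi].
Qed.

Lemma cintegrable_fst (f : Td R n -> R[i]) :
  cintegrable lam f -> cintegrable (lam \x lam)%E (fun z => f z.1).
Proof.
move=> fi; have mf := cintegrable_measurable fi; have [mr mi] := mf.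
have mf2 : cmeasurable (fun z : Td R n * Td R n => f z.1).
  by split; [exact: (measurableT_comp mr)|exact: (measurableT_comp mi)].
apply: cintegrableP => //; have mn := cmeasurable_normc mf2.
have mE : measurable_fun setT (fun z : Td R n * Td R n => (normc (f z.1))%:E).
  exact/measurable_EFinP.
apply: (iffRL (@integrable12ltyP _ _ _ _ _ lam lam _ mE)).
have /integrableP[_] := cintegrable_normc fi; apply: le_lt_trans.
rewrite le_eqVlt; apply/orP; left; apply/eqP; apply: eq_integral => x _ /=.
by rewrite integral_cst// [X in (_ * X)%E](probability_setT lam) mule1.
Qed.

End MixFubini.

(** * Fourier coefficients of ANOVA terms *)

Section FourierPu.
Context {R : realType} {n : nat}.
Local Notation lam := (tlam R n).
Implicit Types (f g : Td R n -> R[i]) (k : freq n) (u v : {set 'I_n}).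

Lemma fcoefD f g k : cintegrable lam f -> cintegrable lam g ->
  fcoef (fun x => f x + g x) k = fcoef f k + fcoef g k.
Proof.
move=> fi gi; rewrite /fcoef -cintegralD; [|exact: cintegrable_twave..].
by apply: eq_cintegral => x; rewrite mulrDl.
Qed.

Lemma fcoefZ c f k : cintegrable lam f -> fcoef (fun x => c * f x) k = c * fcoef f k.
Proof.
move=> fi; rewrite /fcoef -cintegralZ; last exact: cintegrable_twave.
by apply: eq_cintegral => x; rewrite mulrA.
Qed.

Lemma fcoef_sum (I : Type) (r : seq I) (P : pred I) (F : I -> Td R n -> R[i]) k :
  (forall i, cintegrable lam (F i)) ->
  fcoef (fun x => \sum_(i <- r | P i) F i x) k = \sum_(i <- r | P i) fcoef (F i) k.
Proof.
move=> Fi; rewrite /fcoef -cintegral_sum => [|i]; last exact: cintegrable_twave.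
by apply: eq_cintegral => x; rewrite mulr_suml.
Qed.

Lemma cintegrableB f g : cintegrable lam f -> cintegrable lam g ->
  cintegrable lam (fun x => f x - g x).
Proof.
move=> fi gi; rewrite (_ : (fun x => _) = (fun x => f x + -1 * g x)).
  by apply: cintegrableD => //; exact: cintegrableZ.
by apply/funext => x; rewrite mulN1r.
Qed.

Lemma fcoefB f g k : cintegrable lam f -> cintegrable lam g ->
  fcoef (fun x => f x - g x) k = fcoef f k - fcoef g k.
Proof.
move=> fi gi; rewrite (_ : (fun x => _) = (fun x => f x + -1 * g x)).
  by rewrite fcoefD ?fcoefZ ?mulN1r//; exact: cintegrableZ.
by apply/funext => x; rewrite mulN1r.
Qed.

End FourierPu.

Lemma fcoef_one (R : realType) n (k : freq n) :
  fcoef (fun _ : Td R n => 1) k = [forall j, k j == 0]%:R.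
Proof.
elim: n k => [|n IH] k.
  have -> : [forall j, k j == 0] by apply/forallP => -[].
  rewrite /fcoef; under [X in cintegral _ X]funext do
    rewrite /kdot big_ord0 mulr0 oppr0 expi0 mulr1.
  exact: cintegral_cst.
have [g gK Kg] := freq_rcons_bij n; rewrite -(Kg k); case: (g k) => m k' /=.
have [_ ->] := fcoef_rcons k' m (cintegrable_cst (tlam R n.+1) 1).
have -> : [forall j, freq_rcons k' m j == 0] = (m == 0) && [forall j, k' j == 0].
  apply/forallP/andP => [H|[/eqP m0 /forallP k0] j].
    split; first by have := H ord_max; rewrite ffunE unlift_none.
    by apply/forallP => i; have := H (lift ord_max i); rewrite ffunE liftK.
  by rewrite ffunE; case: unliftP => [i|] _; rewrite ?m0.
have E : fcoef1 (fun=> 1) m = (m == 0)%:R :> R[i].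
  rewrite /fcoef1; under [X in cintegral _ X]funext => t do
    rewrite mul1r -mulrN -mulNr -mulrNz.
  by rewrite cintegral_expi oppr_eq0.
rewrite E; case: (m == 0) => /=; first exact: IH.
by rewrite /fcoef; under [X in cintegral _ X]funext do rewrite mul0r; rewrite cintegral0.
Qed.

Section FourierAnova.
Context {R : realType} {n : nat}.
Local Notation lam := (tlam R n).
Implicit Types (f g : Td R n -> R[i]) (k : freq n) (u v : {set 'I_n}).

Definition freq_supp k : {set 'I_n} := [set j | k j != 0].

Lemma in_u_ord u (j : 'I_n) : in_u u j = (j \in u).
Proof.
apply/existsP/idP => [[i /andP[iu /eqP/val_inj <-]]//|ju].
by exists j; rewrite ju eqxx.
Qed.

(** The character at the mixed point is the character of [kon] at [x] times that of [koff] at [y].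
    The mean of the latter is 1 if [koff] vanishes and 0 otherwise; in the first case [kon = k]. *)
Lemma cintegral_twave_mix u k (x : Td R n) :
  cintegral lam (fun y => expi (- (2 * pi * kdot k (mixpt u x y)))) =
  (freq_supp k \subset u)%:R * expi (- (2 * pi * kdot k x)).
Proof.
pose kon : freq n := [ffun j => if j \in u then k j else 0].
pose koff : freq n := [ffun j => if j \in u then 0 else k j].
have E y : expi (- (2 * pi * kdot k (mixpt u x y))) =
    expi (- (2 * pi * kdot kon x)) * (1 * expi (- (2 * pi * kdot koff y))).
  rewrite mul1r -expiD; congr expi; rewrite -opprD -mulrDr; congr (- (_ * _)).
  rewrite /kdot -big_split; apply: eq_bigr => j _.
  rewrite (tcoord_mix (in_u u))// in_u_ord !ffunE.
  by case: ifP => _ /=; rewrite mul0r ?addr0 ?add0r.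
under [X in cintegral _ X]funext => y do rewrite E.
rewrite cintegralZ; last exact/cintegrable_twave/cintegrable_cst.
rewrite -/(fcoef (fun=> 1) koff) fcoef_one mulrC.
have -> : [forall j, koff j == 0] = (freq_supp k \subset u).
  apply/forallP/fintype.subsetP => [H j|H j].
    rewrite inE; have := H j; rewrite ffunE; case: ifP => // _ /eqP ->.
    by rewrite eqxx.
  rewrite ffunE; case: ifPn => // ju; apply: contraNT ju => kj.
  by apply: H; rewrite inE.
case: (boolP (freq_supp k \subset u)) => [/fintype.subsetP su|_]; last by rewrite !mul0r.
rewrite !mul1r; congr (expi (- (_ * kdot _ _))); apply/ffunP => j; rewrite ffunE.
case: ifPn => // ju; apply/esym/eqP; apply: contraNT ju => kj.
by apply: su; rewrite inE.
Qed.

(* [tmix2] moves the averaging over the coordinates outside [u] from [f] to the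
   character. *)
Lemma fcoef_Pu u f k : cintegrable lam f ->
  cintegrable lam (Pu u f) /\ fcoef (Pu u f) k = (freq_supp k \subset u)%:R * fcoef f k.
Proof.
move=> fi.
have i1 := cintegrable_mix (in_u u) (cintegrable_fst fi).
have [Pi _] := cfubini1 i1.
split; first exact: Pi.
have wi : cintegrable (lam \x lam)%E (fun z : Td R n * Td R n =>
    f z.1 * expi (- (2 * pi * kdot k (mixpt u z.1 z.2)))).
  apply: (@cintegrable_bounded _ _ _ _ _ _ 1); first exact: cintegrable_fst.
    apply: cmeasurable_expi; apply: measurableT_comp => //.
    apply: measurable_funM => //.
    exact: (measurableT_comp (measurable_kdot k) (measurable_tmix (in_u u))).
  by move=> t; rewrite normc_expi.
have wi' := cintegrable_mix (in_u u) wi.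
(* The exchange puts the mixed point into [f]; in the character, [tmixK] undoes the mixing and
   leaves [x]. *)
have wE x y : ((fun z : Td R n * Td R n =>
    f z.1 * expi (- (2 * pi * kdot k (mixpt u z.1 z.2)))) \o tmix2 (in_u u)) (x, y) =
    f (mixpt u x y) * expi (- (2 * pi * kdot k x)).
  by rewrite /comp; congr (_ * expi (- (_ * kdot _ _))); exact: tmixK.
have [iG GE] := cfubini1 wi.
have [iG' GE'] := cfubini1 wi'.
transitivity (cintegral lam (fun x => cintegral lam (fun y =>
    f (mixpt u x y) * expi (- (2 * pi * kdot k x))))).
  apply: ae_eq_cintegral.
  - exact: cintegrable_measurable (cintegrable_twave k Pi).
  - have := cintegrable_measurable iG'.
    under [X in cmeasurable X]funext => x do
      under [X in cintegral _ X]funext => y do rewrite wE.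
    exact.
  apply: (@filterS _ _ (ae_filter_ringOfSetsType lam) _ _ _ (ae_cintegrable1 i1)) => x hx.
  rewrite mulrC -cintegralZ//; apply: eq_cintegral => y.
  by rewrite mulrC.
transitivity (cintegral (lam \x lam)%E (fun z : Td R n * Td R n =>
    f z.1 * expi (- (2 * pi * kdot k (mixpt u z.1 z.2))))).
  rewrite -(cintegral_mix (in_u u) wi) -GE'; apply: eq_cintegral => x.
  by apply: eq_cintegral => y; rewrite wE.
rewrite -GE /fcoef -cintegralZ; last exact: cintegrable_twave.
apply: eq_cintegral => x; rewrite [LHS](cintegralZ (f x)).
  by rewrite cintegral_twave_mix mulrCA.
apply: cintegrableP.
  apply: cmeasurable_expi; apply: measurableT_comp => //.
  apply: measurable_funM => //.
  have mxy : measurable_fun setT (fun y : Td R n => mixpt u x y).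
    exact: (measurable_fun_pair2 x (measurable_tmix (in_u u))).
  exact: (measurableT_comp (measurable_kdot k) mxy).
under [X in integrable _ _ X]funext do rewrite normc_expi.
exact: finite_measure_integrable_cst.
Qed.


(* The recursive calls of [anova_aux] have fuel [m] and not [#|v|], hence [<=]. *)
Lemma fcoef_anova_aux m u f k : (#|u| <= m)%N -> cintegrable lam f ->
  cintegrable lam (anova_aux f m u) /\
  fcoef (anova_aux f m u) k = (freq_supp k == u)%:R * fcoef f k.
Proof.
move=> um fi; elim: m u um => [|m IH] u um.
  have [i E] := fcoef_Pu u k fi; split; first exact: i.
  move: um; rewrite leqn0 cards_eq0 => /eqP u0.
  by rewrite -[LHS]/(fcoef (Pu u f) k) E u0 finset.subset0.
have [Pi PE] := fcoef_Pu u k fi.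
(* The value 0 makes the family integrable for every index, as [cintegrable_sum] requires; the
   induction hypothesis speaks only of sets of at most [m] elements. *)
have Vi v : cintegrable lam (fun x => if v \proper u then anova_aux f m v x else 0).
  case: (boolP (v \proper u)) => vu; last exact: cintegrable0.
  by have [] := IH v (leq_trans (proper_card vu) um : (#|v| <= m)%N).
have SE x : \sum_(v : {set 'I_n} | v \proper u) anova_aux f m v x =
    \sum_(v : {set 'I_n}) (if v \proper u then anova_aux f m v x else 0).
  by rewrite big_mkcond.
have -> : anova_aux f m.+1 u = fun x => Pu u f x -
    \sum_(v : {set 'I_n}) (if v \proper u then anova_aux f m v x else 0).
  by apply/funext => x /=; rewrite SE.
have Si := cintegrable_sum (index_enum _) xpredT Vi.
split; first exact: cintegrableB.
rewrite fcoefB// PE fcoef_sum//.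
transitivity ((freq_supp k \subset u)%:R * fcoef f k -
    \sum_(v : {set 'I_n} | v \proper u) (freq_supp k == v)%:R * fcoef f k).
  congr (_ - _); rewrite [RHS]big_mkcond; apply: eq_bigr => v _.
  case: (boolP (v \proper u)) => vu.
    by have [] := IH v (leq_trans (proper_card vu) um : (#|v| <= m)%N).
  by rewrite /fcoef; under [X in cintegral _ X]funext do rewrite mul0r; rewrite cintegral0.
rewrite -mulr_suml -mulrBl; congr (_ * _).
(* At most one term is nonzero, the one at [v = freq_supp k]. Inclusion minus proper inclusion then
   leaves equality. *)
have -> : \sum_(v : {set 'I_n} | v \proper u) (freq_supp k == v)%:R =
    (freq_supp k \proper u)%:R :> R[i].
  rewrite big_mkcond (bigD1 (freq_supp k))//= eqxx big1 ?addr0; first by case: ifP.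
  by move=> v; rewrite eq_sym => /negbTE ->; case: ifP.
rewrite finset.properEneq; case: (eqVneq (freq_supp k) u) => [->|_] /=.
  by rewrite subxx subr0.
by rewrite subrr.
Qed.

Lemma fcoef_sub_TU (U : {set {set 'I_n}}) f k : cintegrable lam f ->
  cintegrable lam (fun x => f x - TU U f x) /\
  fcoef (fun x => f x - TU U f x) k = (freq_supp k \notin U)%:R * fcoef f k.
Proof.
move=> fi.
have Vi v : cintegrable lam (anova_term f v) by have [] := fcoef_anova_aux k (leqnn #|v|) fi.
have Si : cintegrable lam (TU U f).
  exact: (cintegrable_sum (index_enum _) (mem U) Vi).
split; first exact: cintegrableB.
rewrite fcoefB// fcoef_sum//.
transitivity (fcoef f k - \sum_(u in U) (freq_supp k == u)%:R * fcoef f k).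
  congr (_ - _); apply: eq_bigr => u _.
  by have [_ <-] := fcoef_anova_aux k (leqnn #|u|) fi.
rewrite -mulr_suml.
have -> : \sum_(u in U) (freq_supp k == u)%:R = (freq_supp k \in U)%:R :> R[i].
  rewrite big_mkcond (bigD1 (freq_supp k))//= eqxx big1 ?addr0; first by case: ifP.
  by move=> v; rewrite eq_sym => /negbTE ->; case: ifP.
by case: (_ \in _); rewrite ?mul1r ?mul0r ?subrr ?subr0.
Qed.

(** A frequency lies in [Fu u] for exactly one [u], its support, so the existential in [Fout] has
    only one possible witness. *)
Lemma FoutE (U : {set {set 'I_n}}) k : Fout U k <-> freq_supp k \notin U.
Proof.
split=> [[u [uU ku]]|kU].
  rewrite (_ : freq_supp k = u)//; apply/setP => j; rewrite inE.
  have [k0 k1] := ku j.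
  by case: (boolP (j \in u)) => ju; [exact: k1|rewrite k0// eqxx].
exists (freq_supp k); split => // j; rewrite inE negbK.
by split => [/eqP|].
Qed.

End FourierAnova.

(** * Finite sums and the two truncation estimates *)

Lemma esum_le_seq (R : realType) (I : choiceType) (S : set I) (a : I -> \bar R) (M : \bar R) :
  (forall s : seq I, uniq s -> {in s, forall i, S i} -> (\sum_(i <- s) a i <= M)%E) ->
  (\esum_(i in S) a i <= M)%E.
Proof.
move=> H; apply: ge_ereal_sup => _ [X [finX XS] <-].
rewrite fsbig_finite//; apply: H; first exact: finmap.fset_uniq.
by move=> i; rewrite in_fset_set// inE => /XS.
Qed.

Lemma cauchy_schwarz_seq (R : realFieldType) (I : Type) (s : seq I) (x y : I -> R) :
  (\sum_(i <- s) x i * y i) ^+ 2 <= (\sum_(i <- s) x i ^+ 2) * (\sum_(i <- s) y i ^+ 2).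
Proof.
elim: s => [|i s IH]; first by rewrite !big_nil expr0n mul0r.
rewrite !big_cons.
have : 0 <= \sum_(j <- s) x j ^+ 2 by apply: sumr_ge0 => j _; exact: sqr_ge0.
have : 0 <= \sum_(j <- s) y j ^+ 2 by apply: sumr_ge0 => j _; exact: sqr_ge0.
move: IH; set C := \sum_(j <- s) _; set A := \sum_(j <- s) _; set B := \sum_(j <- s) _.
move=> CAB B0 A0; move: (x i) (y i) => a b.
(* These are the terms that the new pair [(a, b)] adds to [A * B - C ^+ 2]. The form is nonnegative
   by completing the square after multiplication by [A]; if [A = 0], then [C = 0]. *)
suff D0 : 0 <= A * b ^+ 2 + B * a ^+ 2 - 2 * C * a * b.
  rewrite -subr_ge0 (_ : _ - _ = (A * B - C ^+ 2) + (A * b ^+ 2 + B * a ^+ 2 - 2 * C * a * b)).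
    by rewrite addr_ge0// subr_ge0.
  by ring.
have [A_eq0|A_neq0] := eqVneq A 0.
  have C0 : C = 0 by apply/eqP; rewrite -sqrf_eq0 eq_le sqr_ge0 (le_trans CAB)// A_eq0 mul0r.
  by rewrite A_eq0 C0 !(mul0r, mulr0) add0r subr0 mulr_ge0// sqr_ge0.
have A_gt0 : 0 < A by rewrite lt_neqAle eq_sym A_neq0.
rewrite -(pmulr_rge0 _ A_gt0).
rewrite (_ : A * (_ - _) = (A * b - C * a) ^+ 2 + (A * B - C ^+ 2) * a ^+ 2); last by ring.
by rewrite addr_ge0 ?sqr_ge0// mulr_ge0 ?sqr_ge0// subr_ge0.
Qed.

Section Truncation.
Context {R : realType} {d : nat}.
Local Notation lam := (tlam R d).
Implicit Types (f : Td R d -> R[i]) (U : {set {set 'I_d}}) (w : freq d -> R).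

(** Both estimates reduce to this. The essential supremum is an infimum of almost everywhere bounds,
    and the coefficients of the remainder vanish off [Fout U], so its full sum is the sum over
    [Fout U]. *)
Lemma Linf_norm_sub_TU_le U f (M : R) : cintegrable lam f ->
  (\esum_(k in Fout U) (normc (fcoef f k))%:E <= M%:E)%E ->
  (Linf_norm (fun x => (f x - TU U f x)%R) <= M%:E)%E.
Proof.
move=> fi fM; apply: ereal_inf_lbound => /=.
have [hi _] := fcoef_sub_TU U [ffun=> 0] fi.
have := @ae_normc_le_fcoef _ _ _ M hi.
under eq_esum => k _ do rewrite (fcoef_sub_TU U k fi).2.
rewrite esum_mkcond in fM.
have E k : (normc ((freq_supp k \notin U)%:R * fcoef f k))%:E =
    (if k \in Fout U then (normc (fcoef f k))%:E else 0)%E.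
  case: ifPn; rewrite ?inE ?notin_setE => /FoutE; first by move=> ->; rewrite mul1r.
  by move=> /negP/negbTE ->; rewrite mul0r Normc.normc0.
under eq_esum => k _ do rewrite E.
move=> /(_ fM); apply: (@filterS _ _ (ae_filter_ringOfSetsType lam)) => x.
by rewrite lee_fin.
Qed.

Lemma inL1_cintegrable f : inL1 f -> cintegrable lam f.
Proof. by case; exact: cintegrableP. Qed.

Lemma inL2_cintegrable f : inL2 f -> cintegrable lam f.
Proof.
case=> mf i2; apply: cintegrableP => //.
(* The dominating function is [1 + |f|^2], as [|f| <= 1 + |f|^2]. *)
have i1 := integrableD measurableT (finite_measure_integrable_cst lam 1 measurableT) i2.
apply: le_integrable i1 => //.
  by apply/measurable_EFinP; exact: cmeasurable_normc.
move=> x _; rewrite /= lee_fin ger0_norm ?normc_ge0// ger0_norm ?addr_ge0 ?sqr_ge0//.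
by have := normc_ge0 (f x); have := sqr_ge0 (normc (f x) - 1); nra.
Qed.

End Truncation.

Theorem theorem4p7 (R : realType) (d : nat) (U : {set {set 'I_d}})
    (w : freq d -> R) :
  anova_subset U ->
  (forall k, 1 <= w k) ->
  (forall f : Td R d -> R[i],
     inAw w f ->
     (Linf_norm (fun x => (f x - TU U f x)%R)
        <= (Aw_norm w f)%:E * (ereal_inf [set (w k)%:E | k in Fout U])^-1)%E)
  /\
  (forall f : Td R d -> R[i],
     inHw w f ->
     (esum setT (fun k => ((w k)^-2)%:E) < +oo)%E ->
     (Linf_norm (fun x => (f x - TU U f x)%R)
        <= (Num.sqrt (fine (esum (Fout U) (fun k => ((w k)^-2)%:E)))
            * Hw_norm w f)%:E)%E).
Proof.
move=> _ w1; have w0 k : 0 < w k by exact: lt_le_trans (w1 k).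
split=> f [].
- move=> fL1 fA; have fi := inL1_cintegrable fL1.
  have Afin : Aw_sum w f \is a fin_num.
    by rewrite ge0_fin_numE//; apply: esum_ge0 => k _; rewrite lee_fin mulr_ge0 ?normc_ge0// ltW.
  set m := ereal_inf _.
  have mw k : Fout U k -> (m <= (w k)%:E)%E.
    by move=> kU; apply: ereal_inf_lbound; exists k.
  have m1 : (1%:E <= m)%E.
    by apply: le_ereal_inf_tmp => _ [k _ <-]; rewrite lee_fin.
  case: m mw m1 => [r mw r1| mw _|//].
    have r0 : 0 < r by apply: lt_le_trans ltr01 _; rewrite -lee_fin.
    rewrite inver gt_eqF// -EFinM; apply: Linf_norm_sub_TU_le => //.
    apply: esum_le_seq => s us sU; rewrite sumEFin lee_fin ler_pdivlMr//.
    rewrite -lee_fin fineK//; apply: (@le_trans _ _ (\sum_(k <- s) (w k * normc (fcoef f k))%:E)%E).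
      rewrite sumEFin lee_fin mulr_suml !big_seq; apply: ler_sum => k ks.
      by rewrite mulrC ler_wpM2r ?normc_ge0// -lee_fin mw//; exact: sU.
    exact: sum_le_esum.
  (* An infinite infimum of real weights means that [Fout U] is empty; the bound is then 0, with the
     inverse of [+oo] equal to 0. *)
  rewrite invey mule0; apply: Linf_norm_sub_TU_le => //.
  apply: esum_le_seq => -[|k s] us sU; first by rewrite big_nil.
  have /mw := sU k (mem_head k s); by rewrite leye_eq.
- move=> fL2 fH wfin; have fi := inL2_cintegrable fL2.
  have Hfin : Hw_sum w f \is a fin_num.
    by rewrite ge0_fin_numE//; apply: esum_ge0 => k _; rewrite lee_fin mulr_ge0 ?sqr_ge0.
  have iw0 k : 0 <= (w k)^-2 by rewrite invr_ge0 sqr_ge0.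
  (* Since [fine] sends [+oo] to 0, the constant in the bound is meaningful only once this sum is
     known to be finite. *)
  have Wfin : (\esum_(k in Fout U) ((w k)^-2)%:E)%E \is a fin_num.
    rewrite ge0_fin_numE; last by apply: esum_ge0 => k _; rewrite lee_fin.
    apply: le_lt_trans wfin; apply: esum_le_seq => s us _.
    exact: sum_le_esum.
  apply: Linf_norm_sub_TU_le => //.
  apply: esum_le_seq => s us sU; rewrite sumEFin lee_fin /Hw_norm -sqrtrM; last first.
    by apply: fine_ge0; apply: esum_ge0 => k _; rewrite lee_fin.
  have s0 : 0 <= \sum_(k <- s) normc (fcoef f k) by apply: sumr_ge0 => k _; exact: normc_ge0.
  rewrite -[leLHS]ger0_norm// -sqrtr_sqr ler_wsqrtr//.
  (* Splitting off the weight makes the two factors of Cauchy-Schwarz the sum of [1 / w^2] and the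
     squared norm in [Hw_sum]. *)
  rewrite (eq_bigr (fun k => (w k)^-1 * (w k * normc (fcoef f k)))); last first.
    by move=> k _; rewrite mulKf// gt_eqF.
  apply: le_trans (cauchy_schwarz_seq _ _ _) _.
  apply: ler_pM; try by apply: sumr_ge0 => k _; exact: sqr_ge0.
  + rewrite -lee_fin fineK// -sumEFin; under eq_bigr do rewrite exprVn.
    exact: sum_le_esum.
  + rewrite -lee_fin fineK// -sumEFin; under eq_bigr do rewrite exprMn.
    by apply: sum_le_esum.
Qed.
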